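(* Let $\{X_j\}_{j\ge 1}$ be a (strictly) stationary sequence of real random variables. The following are equivalent: (i) The sequence $\{X_j\}$ admits a continuous phantom distribution function. (ii) The sequence $\{X_j\}$ admits a regular phantom distribution function. (iii) There exist a sequence $\{v_n\}\subset\mathbb{R}$ and $\gamma\in(0,1)$ such that $$\mathbb{P}(M_n\le v_n)\to\gamma \quad (n\to\infty),$$ and $$\sup_{p,q\in\mathbb{N}}\left|\mathbb{P}(M_{p+q}\le v_n)-\mathbb{P}(M_p\le v_n)\,\mathbb{P}(M_q\le v_n)\right|\to 0 \quad (n\to\infty).$$ (iv) There exist a sequence $\{v_n\}\subset\mathbb{R}$ and $\gamma\in(0,1)$ such that $\mathbb{P}(M_n\le v_n)\to\gamma$ and, for each $T>0$, $$\sup_{p,q\in\mathbb{N},\ p+q\le T n}\left|\mathbb{P}(M_{p+q}\le v_n)-\mathbb{P}(M_p\le v_n)\,\mathbb{P}(M_q\le v_n)\right|\to 0\quad (n\to\infty).$$ (v) There exist a sequence $\{v_n\}\subset\mathbb{R}$ and $\gamma\in(0,1)$ such that for some dense subset $Q\subset\mathbb{R}^+$ $$\mathbb{P}(M_{[nt]}\le v_n)\to\gamma^t\quad (n\to\infty),\qquad t\in Q.$$ Moreover, let $\{v_n\}$ and $\gamma$ be as in (iii), (iv) or (v). If $\{v_n\}$ is strictly increasing, then a continuous phantom distribution function $G$ for $\{X_j\}$ can be defined by $G(x)=\gamma^{g(x)}$, where $$g(x)=\begin{cases} v_1-x+1, & x<v_1,\\[2pt] \dfrac{-x+(n+1)v_{n+1}-n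 v_n}{n(n+1)(v_{n+1}-v_n)}, & v_n\le x<v_{n+1},\\[6pt] 0, & x\ge\sup\{v_n : n\in\mathbb{N}\}.\end{cases}$$ If $\{v_n\}$ is only non-decreasing, let $p_1<p_2<\cdots$ be the indices such that $v_1=\cdots=v_{p_1}<v_{p_1+1}=\cdots=v_{p_2}<v_{p_2+1}=\cdots=v_{p_3}<\cdots$; then a continuous phantom distribution function for $\{X_j\}$ is given by $G(x)=\gamma^{g(x)}$, where $g(x)=v_{p_1}-x+1/p_1$ for $x<v_{p_1}$, $g(v_{p_k})=1/p_k$ for $k=1,2,\dots$, $g$ is linear (affine) between $v_{p_k}$ and $v_{p_{k+1}}$ for $k=1,2,\dots$, and $g(x)=0$ for $x\ge\sup\{v_n: n\in\mathbb{N}\}$.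
   Context: $M_n=\max_{1\le j\le n}X_j$ denotes the partial maximum; $[\cdot]$ is the integer part; $\mathbb{N}=\{1,2,\dots\}$. A distribution function $G$ is a phantom distribution function for the stationary sequence $\{X_j\}$ if $\sup_{u\in\mathbb{R}}|\mathbb{P}(M_n\le u)-G^n(u)|\to 0$ as $n\to\infty$, where $G^n(u)=(G(u))^n$. For a distribution function $G$, its right end is $G_*=\sup\{x: G(x)<1\}$. $G$ is called regular (in the sense of O'Brien) if $G(G_*-)=1$ and $\lim_{x\to G_*-}\frac{1-G(x-)}{1-G(x)}=1$, where $G(x-)$ denotes the left limit at $x$. *)

(* Defs.v *)
From HB Require Import structures.
From mathcomp Require Import all_boot all_order all_algebra.
From mathcomp Require Import all_classical all_reals all_analysis.

Set Implicit Arguments.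
Unset Strict Implicit.
Unset Printing Implicit Defensive.

Import Order.TTheory GRing.Theory Num.Theory.
Import numFieldNormedType.Exports.

Local Open Scope classical_set_scope.
Local Open Scope ring_scope.

(** All sequences are indexed by {1, 2, ...}; since they are encoded as
    functions on [nat], their value at 0 is never used. *)

Section Phantom.
Context (d : measure_display) (T : measurableType d) (R : realType).
Context (P : probability T R) (X : nat -> {RV P >-> R}).

(** Equality of the laws of (X_1, ..., X_k) and (X_{1+h}, ..., X_{k+h}). *)
Definition stationary : Prop :=
  forall (k h : nat) (A : set (k.-tuple (measurableTypeR R))), measurable A ->
    P [set w | A [tuple X i.+1 w | i < k]] =
    P [set w | A [tuple X (i.+1 + h)%N w | i < k]].

(** The maximum over an empty set of indices is -oo. *)
Definition partial_max (n : nat) (w : T) : \bar R :=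
  (\big[maxe/-oo]_(1 <= j < n.+1) (X j w)%:E)%E.

Definition prob_max_le (n : nat) (u : R) : R :=
  fine (P [set w | (partial_max n w <= u%:E)%E]).

Definition distribution_function (G : R -> R) : Prop :=
  exists F : cumulativeBounded (0 : R) (1 : R), G = F :> (R -> R).

Definition phantom_df (G : R -> R) : Prop :=
  distribution_function G /\
  ereal_sup [set (`|prob_max_le n u - G u ^+ n|)%:E | u in [set: R]]
    @[n --> \oo] --> 0%E.

Definition continuous_phantom_df (G : R -> R) : Prop :=
  continuous G /\ phantom_df G.

Definition right_end (G : R -> R) : \bar R :=
  ereal_sup [set x%:E | x in [set x | G x < 1]].

(** The filter x -> e-; the case e = -oo does not arise for the right end of a
    distribution function. *)
Definition left_of (e : \bar R) : set_system R :=
  match e with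
  | r%:E => r^'-
  | +oo%E => pinfty_nbhs R
  | -oo%E => ninfty_nbhs R
  end.

Definition left_limit (G : R -> R) (x : R) : R := lim (G y @[y --> x^'-]).

Definition regular_df (G : R -> R) : Prop :=
  G x @[x --> left_of (right_end G)] --> (1 : R) /\
  (1 - left_limit G x) / (1 - G x) @[x --> left_of (right_end G)] --> (1 : R).

Definition factor_error (v : nat -> R) (n p q : nat) : R :=
  `|prob_max_le (p + q) (v n) - prob_max_le p (v n) * prob_max_le q (v n)|.

Definition cond_iii (v : nat -> R) (gamma : R) : Prop :=
  prob_max_le n (v n) @[n --> \oo] --> gamma /\
  ereal_sup [set (factor_error v n pq.1 pq.2)%:E |
               pq in [set pq : nat * nat | (1 <= pq.1)%N /\ (1 <= pq.2)%N]]
    @[n --> \oo] --> 0%E.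

(** For n so small that no p, q >= 1 satisfy p + q <= S n the supremum below is
    -oo, which does not affect the limit. *)
Definition cond_iv (v : nat -> R) (gamma : R) : Prop :=
  prob_max_le n (v n) @[n --> \oo] --> gamma /\
  forall S : R, 0 < S ->
  ereal_sup [set (factor_error v n pq.1 pq.2)%:E |
               pq in [set pq : nat * nat | [/\ (1 <= pq.1)%N, (1 <= pq.2)%N
                                 & (pq.1 + pq.2)%:R <= S * n%:R]]]
    @[n --> \oo] --> 0%E.

Definition cond_v (v : nat -> R) (gamma : R) : Prop :=
  exists Q : set R,
    [/\ Q `<=` [set t | 0 < t],
        [set t | 0 < t] `<=` closure Q
      & forall t, Q t ->
          prob_max_le (Num.truncn (n%:R * t)) (v n) @[n --> \oo]
            --> gamma `^ t].

End Phantom.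

Section Exponents.
Context (R : realType).
Implicit Types (v : nat -> R) (p : nat -> nat) (g : R -> R).

Definition above_sup v (x : R) : Prop :=
  (ereal_sup [set (v n)%:E | n in [set n | (1 <= n)%N]] <= x%:E)%E.

Definition strictly_increasing v : Prop :=
  forall m n, (1 <= m)%N -> (m < n)%N -> v m < v n.

Definition non_decreasing v : Prop :=
  forall m n, (1 <= m)%N -> (m <= n)%N -> v m <= v n.

Definition exponent_strict v g : Prop :=
  [/\ forall x, x < v 1%N -> g x = v 1%N - x + 1,
      forall n x, (1 <= n)%N -> v n <= x -> x < v n.+1 ->
        g x = (- x + n.+1%:R * v n.+1 - n%:R * v n)
              / (n%:R * n.+1%:R * (v n.+1 - v n))
    & forall x, above_sup v x -> g x = 0].

(** v_1 = ... = v_(p_1) < v_(p_1 + 1) = ... = v_(p_2) < v_(p_2 + 1) = ... *)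
Definition jump_indices v p : Prop :=
  [/\ (1 <= p 1%N)%N /\ (forall k, (1 <= k)%N -> (p k < p k.+1)%N),
      forall n, (1 <= n <= p 1%N)%N -> v n = v (p 1%N),
      forall k n, (1 <= k)%N -> (p k < n <= p k.+1)%N -> v n = v (p k.+1)
    & forall k, (1 <= k)%N -> v (p k) < v (p k).+1].

Definition exponent_jump v p g : Prop :=
  [/\ forall x, x < v (p 1%N) -> g x = v (p 1%N) - x + (p 1%N)%:R^-1,
      forall k, (1 <= k)%N -> g (v (p k)) = (p k)%:R^-1,
      forall k, (1 <= k)%N -> exists a b : R,
        forall x, v (p k) <= x -> x <= v (p k.+1) -> g x = a * x + b
    & forall x, above_sup v x -> g x = 0].

End Exponents.

(* Main.v *)
(** Write [a n u] for [P(M_n <= u)], which is nondecreasing in [u] and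
    nonincreasing in [n].

    From (iv), [a p (v_n)] is asymptotically multiplicative in [p], so that
    [a ([n / k]) (v_n) ^ k] tends to [gamma], and monotonicity in the index gives (v)
    for rational times. From (v), [a (n_k) (v_(m_k)) -> gamma^t] whenever
    [m_k -> oo] and [n_k / m_k -> t]; in particular [a n (v_[nt]) -> gamma^(1/t)].
    When [v] is nondecreasing and [v_n = v_(p_k)] with [p_(k-1) < n <= p_k], this
    forces [p_k / n -> 1], so [G(v_[nt])^n = gamma^(n g(v_[nt]))] has the same limit
    [gamma^(1/t)]. As [1/t] ranges over the positive reals these limits fill [(0, 1)],
    and Polya's monotonicity argument makes [a n u - G(u)^n] uniformly small. A
    general [v] is first replaced by its running maximum.

    From a regular phantom [G], take [v_n] to be quantiles of [G] at the levels
    [gamma^(1/n)]; regularity gives [G(v_n)^n -> gamma], and [a p (v_n)] is close to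
    [G(v_n)^p] uniformly in [p], which yields (iii). *)
Require Import Defs.
From HB Require Import structures.
From mathcomp Require Import all_boot all_order all_algebra.
From mathcomp Require Import all_classical all_reals all_analysis.
From mathcomp Require Import ring lra.

Set Implicit Arguments.
Unset Strict Implicit.
Unset Printing Implicit Defensive.

Import Order.TTheory GRing.Theory Num.Theory.
Import numFieldNormedType.Exports.

Local Open Scope classical_set_scope.
Local Open Scope ring_scope.

(** * Extended-real suprema and epsilon bounds *)

(** Turns the suprema in the definitions into epsilon statements. Eventual nonemptiness of [D n]
    bounds the supremum below by 0, since over the empty set it would be [-oo]. *)
Lemma ereal_sup_cvg0P (R : realType) (I : Type) (D : nat -> set I)
    (f : nat -> I -> R) :
  (forall n i, 0 <= f n i) -> (\forall n \near \oo, D n !=set0) ->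
  ereal_sup [set (f n i)%:E | i in D n] @[n --> \oo] --> 0%E <->
  (forall e, 0 < e -> \forall n \near \oo, forall i, D n i -> f n i <= e).
Proof.
move=> f0 D0; split=> [/fine_cvgP[fin cv] e e0|H].
  near=> n => i Di.
  have fn : ereal_sup [set (f n i)%:E | i in D n] \is a fin_num by near: n.
  have : fine (ereal_sup [set (f n i)%:E | i in D n]) <= e.
    by near: n; exact: (cvgr_le _ cv).
  rewrite -!lee_fin fineK//; apply: le_trans.
  by apply: ereal_sup_ubound; exists i.
have bnd e : 0 < e -> \forall n \near \oo,
    (0 <= ereal_sup [set (f n i)%:E | i in D n] <= e%:E)%E.
  move=> e0; near=> n; apply/andP; split.
    have [i Di] : D n !=set0 by near: n.
    apply: (@le_trans _ _ (f n i)%:E); first by rewrite lee_fin.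
    by apply: ereal_sup_ubound; exists i.
  apply: ge_ereal_sup => _ [i Di <-]; rewrite lee_fin.
  by move: i Di; near: n; exact: H.
apply/fine_cvgP; split.
  near=> n; have /andP[u0 u1] :
      (0 <= ereal_sup [set (f n i)%:E | i in D n] <= 1%:E)%E.
    by near: n; exact: bnd.
  rewrite fin_numElt (lt_le_trans _ u0)//=.
  exact: (le_lt_trans u1 (ltry 1)).
apply/cvgrPdist_le => e e0; near=> n; rewrite sub0r normrN /=.
have /andP[u0 ue] :
    (0 <= ereal_sup [set (f n i)%:E | i in D n] <= e%:E)%E.
  by near: n; exact: bnd.
rewrite ger0_norm ?fine_ge0// -lee_fin fineK//.
by rewrite fin_numElt (lt_le_trans _ u0)//= (le_lt_trans ue (ltry e)).
Unshelve. all: by end_near. Qed.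

(** * Probabilities of the events that a partial maximum stays below a level *)

Section MaxProb.
Context (d : measure_display) (T : measurableType d) (R : realType).
Context (P : probability T R) (X : nat -> {RV P >-> R}).

(** Measurability of the event and its monotonicity in [n] are both read off this intersection. *)
Lemma partial_max_le (n : nat) (u : R) :
  [set w | (partial_max X n w <= u%:E)%E] =
  \bigcap_(j in [set j | (1 <= j < n.+1)%N]) (X j @^-1` `]-oo, u]).
Proof.
rewrite /partial_max; apply/seteqP; split=> w /=.
  move=> + j /= jn; rewrite in_itv/= -lee_fin; apply: le_trans.
  by apply: (@bigmax_sup_seq _ _ _ _ _ j); rewrite ?mem_index_iota.
move=> H; rewrite big_seq_cond; apply: bigmax_le => [|j]; first exact: leNye.
rewrite mem_index_iota andbT => jn.
by have := H j jn; rewrite /= in_itv/= lee_fin.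
Qed.

Lemma measurable_partial_max_le (n : nat) (u : R) :
  measurable [set w | (partial_max X n w <= u%:E)%E].
Proof.
rewrite partial_max_le; apply: bigcap_measurableType.
by move=> j _; rewrite -[X in measurable X]setTI; exact: measurable_funP.
Qed.

Lemma prob_max_le_ge0 (n : nat) (u : R) : 0 <= prob_max_le X n u.
Proof. exact: fine_ge0. Qed.

Lemma prob_max_le_le1 (n : nat) (u : R) : prob_max_le X n u <= 1.
Proof.
rewrite -lee_fin fineK ?fin_num_measure//;
  last exact: measurable_partial_max_le.
by apply: probability_le1; exact: measurable_partial_max_le.
Qed.

Lemma prob_max_le_subset (m n : nat) (u v : R) :
  [set w | (partial_max X m w <= u%:E)%E] `<=`
    [set w | (partial_max X n w <= v%:E)%E] ->
  prob_max_le X m u <= prob_max_le X n v.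
Proof.
move=> uv; rewrite /prob_max_le fine_le ?fin_num_measure//;
  try exact: measurable_partial_max_le.
by apply: le_measure; rewrite ?inE//; exact: measurable_partial_max_le.
Qed.

Lemma prob_max_le_nd (n : nat) : {homo prob_max_le X n : u v / u <= v}.
Proof.
move=> u v uv; apply: prob_max_le_subset => w /= /le_trans; apply.
by rewrite lee_fin.
Qed.

Lemma prob_max_le_ni (m n : nat) (u : R) :
  (m <= n)%N -> prob_max_le X n u <= prob_max_le X m u.
Proof.
move=> mn; apply: prob_max_le_subset; rewrite !partial_max_le.
by move=> w H j /= /andP[j1 jm]; apply: H; rewrite /= j1 (leq_trans jm).
Qed.

Lemma prob_max_le0 (u : R) : prob_max_le X 0 u = 1.
Proof.
rewrite /prob_max_le (_ : [set w | _] = setT) ?probability_setT//.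
apply/seteqP; split=> // w _ /=; rewrite /partial_max big_geq//.
exact: leNye.
Qed.

End MaxProb.

(** * Limits of real powers and of integer parts *)

Lemma cvg_near_eq (R : realType) (I : Type) (F : set_system I)
    {FF : Filter F} (f g : I -> R) (l : R) :
  (\forall x \near F, f x = g x) ->
  f x @[x --> F] --> l -> g x @[x --> F] --> l.
Proof.
by move=> fg; apply: cvg_trans; exact: near_eq_cvg. Qed.

Lemma cvg_powR_l (R : realType) (I : Type) (F : set_system I) {FF : Filter F}
    (f : I -> R) (c l : R) :
  0 < c -> f x @[x --> F] --> l -> c `^ f x @[x --> F] --> c `^ l.
Proof.
move=> c0 fl; rewrite /powR gt_eqF//.
apply: (@cvg_comp _ _ _ (fun x => f x * ln c) expR _ (nbhs (l * ln c))).
  by apply: cvgM => //; exact: cvg_cst.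
exact: continuous_expR.
Qed.

Lemma cvg_powR_r (R : realType) (I : Type) (F : set_system I) {FF : Filter F}
    (f : I -> R) (c l : R) :
  0 < c -> f x @[x --> F] --> c -> f x `^ l @[x --> F] --> c `^ l.
Proof.
move=> c0 fc; have f0 : \forall x \near F, 0 < f x by exact: (cvgr_gt _ fc).
rewrite {2}/powR gt_eqF//.
have : expR (l * ln (f x)) @[x --> F] --> expR (l * ln c).
  apply: (@cvg_comp _ _ _ (fun x => l * ln (f x)) expR _ (nbhs (l * ln c))).
    apply: cvgM; first exact: cvg_cst.
    apply: (@cvg_comp _ _ _ f (@ln R) _ (nbhs c)) => //.
    exact: continuous_ln.
  exact: continuous_expR.
apply: cvg_near_eq; near=> x.
by rewrite /powR gt_eqF//; near: x.
Unshelve. all: by end_near. Qed.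

Lemma truncn_ratio (R : realType) (t : R) : 0 < t ->
  (Num.truncn (n%:R * t))%:R / n%:R @[n --> \oo] --> t.
Proof.
move=> t0; apply/cvgrPdist_le => e e0; near=> n.
have n0 : 0 < n%:R :> R.
  by rewrite ltr0n; near: n; exact: nbhs_infty_gt.
have /andP[h1 h2] := truncn_itv (mulr_ge0 (ltW n0) (ltW t0)).
have ne : e^-1 <= n%:R by near: n; exact: nbhs_infty_ger.
have {}ne : 1 <= n%:R * e by rewrite -ler_pdivrMr// mul1r.
have -> : t = n%:R * t / n%:R by rewrite mulrAC divff ?gt_eqF// mul1r.
rewrite [in X in _ - X]mulrAC divff ?gt_eqF// mul1r.
rewrite -mulrBl ger0_norm ?divr_ge0 ?subr_ge0 ?(ltW n0)//.
rewrite ler_pdivrMr// [leRHS]mulrC; apply: le_trans ne.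
by rewrite lerBlDl natr1 ltW.
Unshelve. all: by end_near. Qed.

Lemma truncn_infty (R : realType) (t : R) : 0 < t ->
  Num.truncn (n%:R * t) @[n --> \oo] --> \oo.
Proof.
move=> t0; apply/cvgnyPge => A; near=> n.
rewrite truncn_ge_nat ?mulr_ge0 ?(ltW t0)// -ler_pdivrMr//.
by near: n; exact: nbhs_infty_ger.
Unshelve. all: by end_near. Qed.

Lemma distribution_function_continuous (R : realType) (G : R -> R) :
  continuous G -> {homo G : x y / x <= y} ->
  G x @[x --> -oo] --> (0 : R) -> G x @[x --> +oo] --> (1 : R) ->
  distribution_function G.
Proof.
move=> cG ndG G0 G1.
have rG : right_continuous G.
  by move=> x; apply: cvg_at_right_filter; exact: cG.
pose C := isCumulative.Build R _ R G ndG rG.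
pose B := isCumulativeBounded.Build R 0 1 G G0 G1.
pose F : cumulativeBounded (0 : R) (1 : R) := HB.pack G C B.
by exists F.
Qed.

(** * The exponent [g] *)

Section Exponent.
Context (R : realType) (v : nat -> R) (p : nat -> nat) (jp : jump_indices v p).

Lemma jump_ge (k : nat) : (1 <= k)%N -> (k <= p k)%N.
Proof.
case: jp => -[p1 pS] _ _ _; elim: k => // -[_ _ //|k IH _].
by apply: leq_ltn_trans (pS k.+1 _); rewrite ?IH.
Qed.

Lemma jump_value_lt (k : nat) : (1 <= k)%N -> v (p k) < v (p k.+1).
Proof.
case: jp => -[p1 pS] _ vp vlt k1; rewrite -(vp k (p k).+1) ?vlt//.
by rewrite ltnSn pS.
Qed.

Lemma jump_value_le (j k : nat) :
  (1 <= j)%N -> (j <= k)%N -> v (p j) <= v (p k).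
Proof.
move=> j1; elim: k => [|k IH]; first by rewrite leqn0 => /eqP ->.
rewrite leq_eqVlt => /predU1P[->//|jk].
by rewrite (le_trans (IH jk))// ltW// jump_value_lt// (leq_trans j1).
Qed.

Lemma jump_inv_lt (k : nat) : (1 <= k)%N -> (p k.+1)%:R^-1 < (p k)%:R^-1 :> R.
Proof.
case: jp => -[p1 pS] _ _ _ k1.
have pk : (0 < p k)%N by rewrite (leq_trans k1)// jump_ge.
by rewrite ltf_pV2 ?posrE ?ltr0n ?ltr_nat ?(leq_trans pk)// ?pS// ltnW// pS.
Qed.

Lemma jump_inv_le (j k : nat) :
  (1 <= j)%N -> (j <= k)%N -> (p k)%:R^-1 <= (p j)%:R^-1 :> R.
Proof.
move=> j1; elim: k => [|k IH]; first by rewrite leqn0 => /eqP ->.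
rewrite leq_eqVlt => /predU1P[->//|jk].
by rewrite (le_trans _ (IH jk))// ltW// jump_inv_lt// (leq_trans j1).
Qed.

(** The least [k] with [n <= p k.+1] puts [n] either in the initial block or strictly after the
    previous jump index, and [v] is constant on each block. *)
Lemma jump_block (n : nat) : (1 <= n)%N ->
  exists k, [/\ (1 <= k)%N, (n <= p k)%N & v (p k) = v n].
Proof.
case: jp => -[p1 pS] vp1 vpS _ n1.
have ex : exists k, (n <= p k.+1)%N.
  by exists n; rewrite (leq_trans _ (jump_ge _)).
case: (ex_minnP ex) => -[|k] nk kmin; first by exists 1%N; rewrite (vp1 n)// n1.
exists k.+2; split => //; rewrite -(vpS k.+1 n)// nk andbT ltnNge.
by apply/negP => /kmin; rewrite ltnn.
Qed.

Lemma above_supP (x : R) :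
  above_sup v x <-> (forall k, (1 <= k)%N -> v (p k) <= x).
Proof.
split=> [vx k k1|vx].
  rewrite -lee_fin; apply: le_trans vx; apply: ereal_sup_ubound.
  by exists (p k) => //=; rewrite (leq_trans k1)// jump_ge.
apply: ge_ereal_sup => _ [n /= n1 <-]; rewrite lee_fin.
by have [k [k1 _ <-]] := jump_block n1; exact: vx.
Qed.

Lemma jump_locate (x : R) : v (p 1%N) <= x -> ~ above_sup v x ->
  exists k, [/\ (1 <= k)%N, v (p k) <= x & x < v (p k.+1)].
Proof.
move=> vx1 nx.
have ex : exists k, x < v (p k.+1).
  apply: contrapT => H; apply: nx; apply/above_supP => -[//|k] _.
  by rewrite leNgt; apply/negP => ?; apply: H; exists k.
case: (ex_minnP ex) => -[|k] xk kmin; first by rewrite ltNge vx1 in xk.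
exists k.+1; split => //; rewrite leNgt; apply/negP => /kmin.
by rewrite ltnn.
Qed.

Lemma not_above_sup (k : nat) (x : R) :
  (1 <= k)%N -> x < v (p k) -> ~ above_sup v x.
Proof. by move=> k1 xk /above_supP /(_ k k1); rewrite leNgt xk. Qed.

Lemma exponent_jump_ex : exists g : R -> R, exponent_jump v p g.
Proof.
(* [idx x] selects the piece containing [x]; [idxE] shows it is unique, the values [v (p k)] being
   strictly increasing. *)
pose idx (x : R) := xget 0%N
  [set k | [/\ (1 <= k)%N, v (p k) <= x & x < v (p k.+1)]].
have idxE k x : (1 <= k)%N -> v (p k) <= x -> x < v (p k.+1) -> idx x = k.
  move=> k1 kx xk; rewrite /idx.
  case: xgetP => [j _ [j1 jx xj]|/(_ k)]; last by case.
  apply/eqP; rewrite eqn_leq; apply/andP; split; rewrite leqNgt; apply/negP.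
    by move=> /(jump_value_le (ltn0Sn _)); lra.
  by move=> /(jump_value_le (ltn0Sn _)); lra.
pose w k := v (p k); pose q k : R := (p k)%:R^-1.
(* Slope of the chord joining [(w k, q k)] to [(w k.+1, q k.+1)]. *)
pose s k := (q k.+1 - q k) / (w k.+1 - w k).
pose g x := if `[< above_sup v x >] then 0 else
  if x < w 1%N then w 1%N - x + q 1%N else
  let k := idx x in s k * x + (q k - s k * w k).
have gk k x : (1 <= k)%N -> w k <= x -> x < w k.+1 ->
    g x = s k * x + (q k - s k * w k).
  move=> k1 kx xk; rewrite /g asboolF; last exact: (not_above_sup _ xk).
  rewrite ltNge (le_trans _ kx) ?jump_value_le//=.
  by rewrite (idxE k).
have gp k : (1 <= k)%N -> g (w k) = q k.
  by move=> k1; rewrite (gk k)// ?jump_value_lt// addrC subrK.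
exists g; split=> [x x1|//|k k1|x /asboolP]; last by rewrite /g => ->.
  by rewrite /g asboolF ?x1//; exact: (not_above_sup _ x1).
exists (s k), (q k - s k * w k) => x kx.
rewrite le_eqVlt => /predU1P[->|xk]; last exact: gk.
rewrite -/(w k.+1) gp// /s.
have := jump_value_lt k1; rewrite -/(w k.+1) -/(w k) => wk.
by field; rewrite subr_eq0 gt_eqF.
Qed.

Context (g : R -> R) (gp : exponent_jump v p g).

(** The piece is affine and falls from [1 / p k] to [1 / p k.+1], so its slope cannot be
    positive. *)
Lemma exponent_piece_le (k : nat) (x y : R) : (1 <= k)%N ->
  v (p k) <= x -> x <= y -> y <= v (p k.+1) -> g y <= g x.
Proof.
case: gp => _ gv gaff _ k1 kx xy yk; have [A [B AB]] := gaff k k1.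
have w := jump_value_lt k1.
have := jump_inv_lt k1; rewrite -!gv//.
rewrite !AB ?lexx ?(ltW w)// ?(le_trans xy)// ?(le_trans kx)// => AB'.
have A0 : A <= 0.
  rewrite leNgt; apply/negP => A0.
  have : 0 < A * (v (p k.+1) - v (p k)) by rewrite mulr_gt0// subr_gt0.
  by lra.
by rewrite lerD2r ler_wnM2l.
Qed.

Lemma exponent_piece_bounds (k : nat) (x : R) : (1 <= k)%N ->
  v (p k) <= x -> x <= v (p k.+1) ->
  (p k.+1)%:R^-1 <= g x <= (p k)%:R^-1.
Proof.
case: (gp) => _ gv _ _ k1 kx xk; rewrite -!gv//; apply/andP; split.
  exact: (exponent_piece_le k1).
exact: (exponent_piece_le k1).
Qed.

(** Either [x] is above the supremum, where [g] vanishes, or it lies in a piece of index at least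
    [k]. This bound yields the decay of [g] towards the supremum of [v] and at [+oo]. *)
Lemma exponent_bounds (k : nat) (x : R) : (1 <= k)%N ->
  v (p k) <= x -> 0 <= g x <= (p k)%:R^-1.
Proof.
case: (gp) => _ _ _ gabove k1 kx.
have [/gabove ->|nx] := pselect (above_sup v x).
  by rewrite lexx invr_ge0 ler0n.
have [j [j1 jx xj]] :=
  jump_locate (le_trans (jump_value_le (leqnn 1) k1) kx) nx.
have /andP[g0 gj] := exponent_piece_bounds j1 jx (ltW xj).
rewrite (le_trans _ g0) ?invr_ge0//= (le_trans gj)// jump_inv_le//.
rewrite leqNgt; apply/negP => /(jump_value_le (ltn0Sn _)).
by rewrite leNgt (le_lt_trans kx).
Qed.

Lemma exponent_ni (x y : R) : x <= y -> g y <= g x.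
Proof.
case: (gp) => g1 _ _ gabove xy.
have [x1|x1] := ltP x (v (p 1%N)).
  have [y1|y1] := ltP y (v (p 1%N)); first by rewrite !g1//; lra.
  have /andP[_ gy] := exponent_bounds (leqnn 1) y1.
  by rewrite (le_trans gy)// g1//; lra.
have [ax|ax] := pselect (above_sup v x).
  have ay : above_sup v y by apply: le_trans ax _; rewrite lee_fin.
  by rewrite !gabove.
have [j [j1 jx xj]] := jump_locate x1 ax.
have [yj|jy] := leP y (v (p j.+1)); first exact: (exponent_piece_le j1).
have /andP[_ gy] := exponent_bounds (ltn0Sn j) (ltW jy).
have /andP[gx _] := exponent_piece_bounds j1 jx (ltW xj).
exact: le_trans gx.
Qed.

Lemma jump_inv_small (e : R) : 0 < e ->
  exists2 k, (1 <= k)%N & (p k)%:R^-1 <= e.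
Proof.
move=> e0; exists (Num.truncn e^-1).+1 => //.
rewrite -[leRHS]invrK lef_pV2 ?posrE ?invr_gt0//; last first.
  by rewrite ltr0n (leq_trans _ (jump_ge _)).
rewrite (le_trans (ltW (truncnS_gt _)))// ler_nat.
exact: jump_ge.
Qed.

(** The affine pieces are glued one at a time along closed sets, by induction on [k]. *)
Lemma exponent_within (k : nat) : (1 <= k)%N ->
  {within `]-oo, v (p k)], continuous g}.
Proof.
case: gp => g1 gv gaff _; elim: k => // -[_ _|k IH _].
  apply: (@subspace_eq_continuous _ _ _
    (fun x => v (p 1%N) - x + (p 1%N)%:R^-1)).
    have E (x : R) : x <= v (p 1%N) -> v (p 1%N) - x + (p 1%N)%:R^-1 = g x.
      by rewrite le_eqVlt => /predU1P[->|/g1 ->//]; rewrite gv// subrr add0r.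
    by move=> x; rewrite inE/= in_itv/= => /E.
  apply: continuous_subspaceT => x; apply: cvgD; last exact: cvg_cst.
  by apply: cvgB; [exact: cvg_cst|exact: cvg_id].
have wk := ltW (jump_value_lt (ltn0Sn k)).
have -> : `]-oo, v (p k.+2)]%classic =
    `]-oo, v (p k.+1)] `|` `[v (p k.+1), v (p k.+2)] :> set R.
  apply/seteqP; split=> x /=; rewrite !in_itv/=.
    by move=> ->; case: (leP x (v (p k.+1))) => [|/ltW ->]; [left|right].
  by case=> [/le_trans|/andP[]//]; apply.
apply: withinU_continuous;
  [exact: lray_closed|exact: itv_closed|exact: IH|].
have [A [B AB]] := gaff k.+1 (ltn0Sn k).
apply: (@subspace_eq_continuous _ _ _ (fun x => A * x + B)).
  by move=> x; rewrite inE/= in_itv/= => /andP[kx xk]; exact/esym/AB.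
apply: continuous_subspaceT => x; apply: cvgD; last exact: cvg_cst.
by apply: cvgM; [exact: cvg_cst|exact: cvg_id].
Qed.

(** A point not above the supremum lies in some open ray [x < v (p k)], covered by
    [exponent_within]. Elsewhere [g x = 0], and nearby values are at most [1 / p k] for any
    prescribed [k]. *)
Lemma exponent_continuous : continuous g.
Proof.
move=> x; have [/above_supP ax|nx] := pselect (above_sup v x).
  case: (gp) => _ _ _ gabove.
  rewrite /continuous_at gabove; last exact/above_supP.
  apply/cvgr0Pnorm_le => e e0; have [k k1 ke] := jump_inv_small e0.
  near=> y; have ky : v (p k) <= y.
    (* Passing to [k.+1] makes the inequality strict: [v (p k) < v (p k.+1) <= x], so a whole
       neighbourhood of [x] stays above [v (p k)]. *)
    apply: ltW; near: y; apply: lt_nbhsr.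
    exact: lt_le_trans (jump_value_lt k1) (ax k.+1 _).
  have /andP[g0 gy] := exponent_bounds k1 ky.
  by rewrite ger0_norm// (le_trans gy).
have [k k1 xk] : exists2 k, (1 <= k)%N & x < v (p k).
  apply: contrapT => H; apply: nx; apply/above_supP => k k1.
  by rewrite leNgt; apply/negP => ?; apply: H; exists k.
have := exponent_within k1.
move=> /(continuous_subspaceW (A := `]-oo, v (p k)[)) => /(_ _).
rewrite continuous_open_subspace//; apply; last by rewrite inE/= in_itv.
by apply: subset_itvl; rewrite bnd_simp.
Unshelve. all: by end_near. Qed.

Context (gamma : R) (gamma01 : 0 < gamma < 1).

Lemma exponent_df : distribution_function (fun x => gamma `^ g x).
Proof.
case/andP: gamma01 => g0 g1; case: (gp) => gl _ _ _.
have lg0 : ln gamma < 0 by rewrite ln_lt0// g0.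
apply: distribution_function_continuous.
- by move=> x; apply: cvg_powR_l => //; exact: exponent_continuous.
- by move=> x y xy; apply: ger_powR; [rewrite g0 (ltW g1)|exact: exponent_ni].
- apply: (@cvg_near_eq _ _ _ _ (fun x => expR (- (g x * - ln gamma)))).
    by near=> x; rewrite /powR gt_eqF// mulrN opprK.
  apply: (@cvg_comp _ _ _ (fun x => g x * - ln gamma)
    (fun y => expR (- y)) _ +oo).
    apply/cvgryPge => A; near=> x.
    rewrite -ler_pdivrMr ?oppr_gt0//.
    have x1 : x < v (p 1%N) by near: x; apply: nbhs_ninfty_lt; exact: num_real.
    rewrite gl// -lerBlDr lerBrDr addrC -lerBrDr.
    by near: x; apply: nbhs_ninfty_le; exact: num_real.
  exact: cvgr_expR.
- rewrite -[X in _ --> X](powRr0 gamma); apply: cvg_powR_l => //.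
  apply/cvgr0Pnorm_le => e e0; have [k k1 ke] := jump_inv_small e0.
  near=> x; have kx : v (p k) <= x.
    by near: x; apply: nbhs_pinfty_ge; exact: num_real.
  have /andP[gx0 gx] := exponent_bounds k1 kx.
  by rewrite ger0_norm// (le_trans gx).
Unshelve. all: by end_near. Qed.

End Exponent.

(** * Existence of jump indices, and the strictly increasing case *)

Lemma jump_indices_ex (R : realType) (v : nat -> R) : non_decreasing v ->
  (forall n, exists m, (n <= m)%N && (v m < v m.+1)) ->
  exists p, jump_indices v p.
Proof.
move=> v_nd jump; pose next n := ex_minn (jump n).
have nextP n : [/\ (n <= next n)%N, v (next n) < v (next n).+1 &
    forall m, (n <= m <= next n)%N -> (1 <= m)%N -> v m = v (next n)].
  rewrite /next; case: ex_minnP => m /andP[nm vm] mmin; split => // j.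
  (* Induction on the distance to the jump [m]: a strict step at an earlier [j] would contradict the
     minimality of [m]. *)
  move=> /andP[nj jm] j1; rewrite -(subnK jm); move: (m - j)%N (subnKC jm) => i.
  elim: i => [|i IH] in j nj jm j1 *; first by rewrite add0n.
  move=> ijm; rewrite addSnnS -IH//;
    [|exact: leqW|by rewrite -ijm addnS ltnS leq_addr|by rewrite addSnnS].
  apply: le_anti; rewrite v_nd//= leNgt; apply/negP => vj.
  have := mmin j; rewrite nj vj => /(_ isT).
  by rewrite -ijm leqNgt addnS ltnS leq_addr.
(* Restarting the search at [n.+1] makes [p] strictly increasing, and the start at 0 gives
   [p 1 = next 1]. *)
pose p k := iter k (fun n => next n.+1) 0%N; exists p; split.
- split=> [|k _]; first by have [] := nextP 1%N.
  by rewrite [ltnRHS]iterS; have [] := nextP (p k).+1.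
- by move=> n /andP[n1 nn]; have [_ _] := nextP 1%N; apply; rewrite ?n1.
- move=> k n k1 /andP[kn nk]; rewrite /p iterS.
  have [_ _] := nextP (p k).+1; apply.
    by rewrite kn.
  exact: leq_ltn_trans kn.
- by move=> [//|k] _; rewrite /p iterS; have [] := nextP (p k).+1.
Qed.

Lemma jump_indices_id (R : realType) (v : nat -> R) :
  strictly_increasing v -> jump_indices v id.
Proof.
move=> vlt; split=> //.
- by move=> n; rewrite -eqn_leq eq_sym => /eqP ->.
- by move=> k n k1; rewrite -eqn_leq => /eqP <-.
- by move=> k k1; exact: vlt.
Qed.

(** For [p = id] the chord from [1 / n] to [1 / n.+1] has slope [- 1 / (n * n.+1 * (v n.+1 - v n))],
    because [1 / n - 1 / n.+1 = 1 / (n * n.+1)]. *)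
Lemma exponent_strictP (R : realType) (v : nat -> R) (g : R -> R) :
  strictly_increasing v -> exponent_strict v g <-> exponent_jump v id g.
Proof.
move=> vlt; have n0 n : (1 <= n)%N -> n%:R != 0 :> R by rewrite pnatr_eq0 -lt0n.
have vS n : (1 <= n)%N -> v n.+1 - v n != 0.
  by move=> n1; rewrite subr_eq0 gt_eqF// vlt.
have n1E n : n.+1%:R = n%:R + 1 :> R by rewrite natr1.
have nS0 n : n%:R + 1 != 0 :> R by rewrite natr1.
split=> -[g1 g2 g3]; last move=> g4.
- have gv k : (1 <= k)%N -> g (v k) = k%:R^-1.
    move=> k1; rewrite (g2 k) ?vlt//.
    by rewrite n1E; field; rewrite n0// vS// nS0.
  split=> //; first by move=> x x1; rewrite g1// invr1.
  move=> k k1; pose D := (k%:R * k.+1%:R * (v k.+1 - v k)).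
  exists (- D^-1), ((k.+1%:R * v k.+1 - k%:R * v k) / D) => x kx.
  (* The explicit formula holds on a half-open interval, so at the right end the value comes from
     the next piece through [gv]. *)
  rewrite le_eqVlt => /predU1P[->|xk].
    by rewrite gv// /D n1E; field; rewrite n0// vS// nS0.
  by rewrite (g2 k)// -/D; ring.
- split=> //; first by move=> x x1; rewrite g1// invr1.
  move=> k x k1 kx xk; have [A [B AB]] := g3 k k1.
  have v1 := ltW (vlt _ _ k1 (ltnSn k)).
  have := g2 k k1; rewrite AB// => e1.
  have := g2 k.+1 isT; rewrite /= AB// => e2.
  rewrite AB// ?ltW//.
  have AE : A = (k.+1%:R^-1 - k%:R^-1) / (v k.+1 - v k).
    by rewrite -e1 -e2; field; exact: vS.
  have BE : B = k%:R^-1 - A * v k by rewrite -e1; ring.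
  by rewrite BE AE n1E; field; rewrite n0// vS// nS0.
Qed.

(** * Regular distribution functions *)

Lemma left_of_filter (R : realType) (e : \bar R) : Filter (left_of e).
Proof. by case: e => [r| |] /=; exact: _. Qed.

Section DistributionFunction.
Context (R : realType) (G : R -> R) (dG : distribution_function G).

Lemma df_nd : {homo G : x y / x <= y}.
Proof. by case: dG => F ->; exact: cumulative_is_nondecreasing. Qed.

Lemma df_cvgy : G x @[x --> +oo] --> (1 : R).
Proof. by case: dG => F ->; exact: cumulativey. Qed.

Lemma df_cvgNy : G x @[x --> -oo] --> (0 : R).
Proof. by case: dG => F ->; exact: cumulativeNy. Qed.

Lemma df_right_continuous : right_continuous G.
Proof. by case: dG => F ->; exact: cumulative_is_right_continuous. Qed.

Lemma df_bounds (x : R) : 0 <= G x <= 1.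
Proof.
apply/andP; split.
  apply: (cvgr_to_le df_cvgNy); near=> y; apply: df_nd.
  by near: y; apply: nbhs_ninfty_le; exact: num_real.
apply: (cvgr_to_ge df_cvgy); near=> y; apply: df_nd.
by near: y; apply: nbhs_pinfty_ge; exact: num_real.
Unshelve. all: by end_near. Qed.

Lemma lt_right_end (x : R) : (x%:E < right_end G)%E -> G x < 1.
Proof.
apply: contraPlt => Gx; apply/negP; rewrite -leNgt.
apply: ge_ereal_sup => _ [y /= Gy <-]; rewrite lee_fin leNgt.
by apply/negP => /ltW /df_nd; lra.
Qed.

Lemma right_end_neqNy : right_end G != -oo%E.
Proof.
have [M [_ MP]] := cvgr_lt _ df_cvgNy _ (@ltr01 R).
apply/eqP => rN; have : ((M - 1)%:E <= right_end G)%E.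
  by apply: ereal_sup_ubound; exists (M - 1) => //; apply: MP; lra.
by rewrite rN.
Qed.

(** Treats finite and infinite right ends uniformly. *)
Lemma left_ofP (e : \bar R) (A : set R) : e != -oo%E ->
  left_of e A <->
  exists2 z : R, (z%:E < e)%E & forall x, z < x -> (x%:E < e)%E -> A x.
Proof.
case: e => [r| |]// _ /=; split.
- move=> [d /= d0 dA]; exists (r - d); first by rewrite lte_fin; lra.
  move=> x rx; rewrite lte_fin => xr; apply: dA => //=.
  by rewrite ger0_norm; lra.
- move=> [z]; rewrite lte_fin => zr zA; near=> x; apply: zA.
    by near: x; exact: nbhs_left_gt.
  by rewrite lte_fin; near: x; exact: nbhs_left_lt.
- by move=> [M [_ MA]]; exists M; rewrite ?ltry// => x /MA.
- move=> [z _ zA]; near=> x; apply: zA; rewrite ?ltry//.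
  by near: x; apply: nbhs_pinfty_gt; exact: num_real.
Unshelve. all: by end_near. Qed.

(** At a finite right end [r], [G r < 1] would persist slightly beyond [r] by continuity,
    contradicting the supremum. Left limits equal values, so the ratio is identically 1 before the
    right end. *)
Lemma continuous_regular : continuous G -> regular_df G.
Proof.
move=> cG; split.
  have := right_end_neqNy; have Glt := lt_right_end.
  have rub y : G y < 1 -> (y%:E <= right_end G)%E.
    by move=> Gy; apply: ereal_sup_ubound; exists y.
  case: (right_end G) rub Glt => [r| |]// rub Glt _ /=; last exact: df_cvgy.
  suff <- : G r = 1 by apply: cvg_at_left_filter; exact: cG.
  have /andP[_] := df_bounds r; rewrite le_eqVlt => /predU1P[//|Gr].
  have : \forall y \near r, G y < 1 by exact: (cvgr_lt _ (cG r)).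
  move=> /nbhs_ballP[d /= d0 dr].
  have : ((r + d / 2)%:E <= r%:E)%E.
    apply: rub; apply: dr; rewrite /ball/= opprD addNKr normrN.
    by rewrite ger0_norm; lra.
  by rewrite lee_fin; lra.
move=> A /nbhs_singleton A1; apply/left_ofP; first exact: right_end_neqNy.
have [M [_ MP]] := cvgr_lt _ df_cvgNy _ (@ltr01 R).
exists (M - 2).
  apply: (@lt_le_trans _ _ (M - 1)%:E); first by rewrite lte_fin; lra.
  by apply: ereal_sup_ubound; exists (M - 1) => //; apply: MP; lra.
move=> x _ /lt_right_end Gx /=.
have -> : left_limit G x = G x.
  by apply: cvg_lim => //; apply: cvg_at_left_filter; exact: cG.
by rewrite divff// subr_eq0 gt_eqF.
Qed.

(** The quantile is the infimum of the points where [c <= G]; right continuity shows that this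
    infimum is attained. *)
Lemma df_quantile (c : R) : 0 < c < 1 ->
  exists2 x, c <= G x & forall y, y < x -> G y < c.
Proof.
case/andP=> c0 c1; pose S := [set x | c <= G x].
have [M [_ MP]] := cvgr_ge _ df_cvgy _ c1.
have [m [_ mP]] := cvgr_lt _ df_cvgNy _ c0.
have lS : lbound S m.
  move=> x /= cx; rewrite leNgt; apply/negP => /mP /=.
  by rewrite ltNge cx.
have S0 : S !=set0 by exists (M + 1); apply: MP; lra.
have hS : has_inf S by split => //; exists m.
exists (inf S); last first.
  move=> y yS; rewrite ltNge; apply/negP => cy.
  have : inf S <= y by apply: ge_inf => //; exists m.
  by rewrite leNgt yS.
have rc : G y @[y --> (inf S)^'+] --> G (inf S) by exact: df_right_continuous.
apply: (cvgr_to_ge rc); near=> y.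
have Sy : inf S < y by near: y; exact: nbhs_right_gt.
have [s Ss sy] := inf_lt S0 Sy.
by rewrite (le_trans Ss)// df_nd// ltW.
Unshelve. all: by end_near. Qed.

Lemma df_left_limit_le (c x : R) : (forall y, y < x -> G y < c) ->
  left_limit G x <= c.
Proof.
move=> Gc; apply: limr_le.
  apply: nondecreasing_at_left_is_cvgr.
    by near=> y => s t _ _; exact: df_nd.
  by near=> y; exists 1 => _ [s _ <-]; have /andP[] := df_bounds s.
near=> y; apply/ltW/Gc; near: y; exact: nbhs_left_lt.
Unshelve. all: by end_near. Qed.

(** [v n] is the quantile of [G] at level [c n = gamma `^ n^-1]. Regularity makes
    the jump of [G] at [v n] negligible with respect to [1 - G (v n)], hence
    [n * (1 - G (v n))] is asymptotically [n * (1 - c n)], i.e. [- ln gamma]. *)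
Lemma regular_sequence (gamma : R) : 0 < gamma < 1 -> regular_df G ->
  exists2 v : nat -> R, G (v n) @[n --> \oo] --> (1 : R) &
    G (v n) ^+ n @[n --> \oo] --> gamma.
Proof.
move=> /andP[g0 g1] [G1 Grat].
have lg : ln gamma < 0 by rewrite ln_lt0// g0.
pose c n := gamma `^ (n%:R^-1).
have c_gt0 n : 0 < c n by exact: powR_gt0.
have c_lt1 n : (0 < n)%N -> c n < 1.
  move=> n0; rewrite /c /powR gt_eqF// expR_lt1 nmulr_llt0//.
  by rewrite invr_gt0 ltr0n.
have cn n : (0 < n)%N -> c n ^+ n = gamma.
  move=> n0; rewrite -powR_mulrn ?ltW// -powRrM mulVf ?pnatr_eq0 -?lt0n//.
  by rewrite powRr1 ?ltW.
have c1 : c n @[n --> \oo] --> (1 : R).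
  rewrite -[X in _ --> X](powRr0 gamma); apply: cvg_powR_l => //.
  apply/cvgr0Pnorm_le => e e0; near=> n.
  have n0 : 0 < n%:R :> R by rewrite ltr0n; near: n; exact: nbhs_infty_gt.
  rewrite ger0_norm ?invr_ge0// -[leRHS]invrK lef_pV2 ?posrE ?invr_gt0//.
  by near: n; exact: nbhs_infty_ger.
have [v vP] : {v : nat -> R & forall n, (0 < n)%N ->
    c n <= G (v n) /\ forall y, y < v n -> G y < c n}.
  apply: (@choice _ _ (fun n x => (0 < n)%N ->
    c n <= G x /\ forall y, y < x -> G y < c n)) => n.
  have [->|n0] := posnP n; first by exists 0.
  have [|x cx xc] := @df_quantile (c n); first by rewrite c_gt0 c_lt1.
  by exists x.
have Gv1 : G (v n) @[n --> \oo] --> (1 : R).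
  apply: (squeeze_cvgr _ c1 (cvg_cst (1 : R))); near=> n.
  have n0 : (0 < n)%N by near: n; exact: nbhs_infty_gt.
  by rewrite (vP n n0).1; have /andP[] := df_bounds (v n).
(* As [G] tends to 1 before its right end, it exceeds [c n < 1] at some point before it, and the
   quantile is no further right. *)
have v_lt n : (0 < n)%N -> ((v n)%:E < right_end G)%E.
  move=> n0; have : left_of (right_end G) [set x | c n < G x].
    have FF := left_of_filter (right_end G).
    exact: (cvgr_gt _ G1 _ (c_lt1 n n0)).
  move=> /(left_ofP _ right_end_neqNy)[z ze zA].
  have [y zy ye] : exists2 y, z < y & (y%:E < right_end G)%E.
    case: (right_end G) ze => [r| |]//; last first.
      by exists (z + 1); rewrite ?ltry//; lra.
    by rewrite lte_fin => zr; exists ((z + r) / 2); rewrite ?lte_fin; lra.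
  apply: le_lt_trans (ye); rewrite lee_fin leNgt; apply/negP => yv.
  have := zA y zy ye; have := (vP n n0).2 y yv.
  by rewrite /=; lra.
have v_cvg : v n @[n --> \oo] `=>` left_of (right_end G).
  move=> A /(left_ofP _ right_end_neqNy)[z ze zA].
  change (\forall n \near \oo, A (v n)); near=> n; apply: zA.
    rewrite ltNge; apply/negP => /df_nd; apply/negP; rewrite -ltNge.
    near: n; apply: (cvgr_gt _ Gv1); exact: lt_right_end.
  by apply: v_lt; near: n; exact: nbhs_infty_gt.
exists v => //.
pose r n := (1 - left_limit G (v n)) / (1 - G (v n)).
have r1 : r n @[n --> \oo] --> (1 : R) by exact: (cvg_comp _ _ v_cvg Grat).
have U : expR (ln gamma * (c n / r n)) @[n --> \oo] --> gamma.
  rewrite -[X in _ --> X](@lnK _ gamma) ?posrE//.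
  apply: (@cvg_comp _ _ _ (fun n => ln gamma * (c n / r n)) expR _
    (nbhs (ln gamma))).
    suff : ln gamma * (c n / r n) @[n --> \oo] --> ln gamma * (1 / 1).
      by rewrite divr1 mulr1.
    apply: cvgM; first exact: cvg_cst.
    by apply: cvgM => //; apply: cvgV => //; exact: oner_neq0.
  exact: continuous_expR.
apply: (squeeze_cvgr _ (cvg_cst gamma) U); near=> n.
have n0 : (0 < n)%N by near: n; exact: nbhs_infty_gt.
have n0R : 0 < n%:R :> R by rewrite ltr0n.
have [cG Gc] := vP n n0; have /andP[Gv0 _] := df_bounds (v n).
rewrite -{1}(cn n n0) lerXn2r ?nnegrE ?(ltW (c_gt0 n))//=.
have Gvn : G (v n) < 1 by exact/lt_right_end/v_lt.
have r0 : 0 < r n by near: n; exact: (cvgr_gt _ r1).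
have rE : 1 - G (v n) = (1 - left_limit G (v n)) / r n.
  rewrite /r invf_div mulrCA mulfV ?mulr1//.
  apply/eqP => z; move: r0; rewrite /r z mul0r ltxx//.
(* The inequality [1 + x <= expR x] at [x = - ln gamma / n], where [expR x] is the inverse of
   [c n]. *)
have h1 : c n * (- ln gamma) <= n%:R * (1 - c n).
  have := expR_ge1Dx (- ln gamma / n%:R).
  have -> : expR (- ln gamma / n%:R) = (c n)^-1.
    by rewrite /c /powR gt_eqF// mulNr expRN mulrC.
  rewrite -[X in _ <= X]mul1r ler_pdivlMr// => h.
  have : n%:R * ((1 + - ln gamma / n%:R) * c n) <= n%:R * 1 by rewrite ler_pM2l.
  have -> : n%:R * ((1 + - ln gamma / n%:R) * c n) =
      n%:R * c n - ln gamma * c n.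
    by field; rewrite gt_eqF.
  by lra.
have h2 : n%:R * (G (v n) - 1) <= ln gamma * (c n / r n).
  have -> : n%:R * (G (v n) - 1) = - (n%:R * (1 - left_limit G (v n)) / r n).
    by rewrite -mulrA -rE; ring.
  have -> : ln gamma * (c n / r n) = - (c n * (- ln gamma) / r n) by ring.
  rewrite lerN2 ler_pM2r ?invr_gt0//; apply: le_trans h1 _.
  by rewrite ler_pM2l// lerD2l lerN2; exact: df_left_limit_le.
(* Again [1 + x <= expR x], now at [x = G (v n) - 1]; [h2] then bounds the exponent after raising to
   the power [n]. *)
apply: (@le_trans _ _ (expR (G (v n) - 1) ^+ n)).
  rewrite lerXn2r ?nnegrE ?expR_ge0//.
  by rewrite (le_trans _ (expR_ge1Dx _))// addrC subrK.
by rewrite -expRM_natl ler_expR.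
Unshelve. all: by end_near. Qed.

End DistributionFunction.

(** * Asymptotics of the distribution functions of maxima *)

(** [a n u] stands for [prob_max_le X n u]. *)
Section Asymptotics.
Context (R : realType) (a : nat -> R -> R).
Context (a0 : forall u, a 0 u = 1).
Context (a_ge0 : forall n u, 0 <= a n u) (a_le1 : forall n u, a n u <= 1).
Context (a_nd : forall n, {homo a n : u v / u <= v}).
Context (a_ni : forall m n u, (m <= n)%N -> a n u <= a m u).
Implicit Types (v : nat -> R) (gamma : R).

(** Polya's argument: the [n]-dependent points [u n] play the role of the quantiles
    of a limit law. *)
Lemma polya_uniform (b : nat -> R -> R) :
    (forall n u, 0 <= b n u) -> (forall n u, b n u <= 1) ->
    (forall n, {homo b n : u v / u <= v}) ->
    (forall y : R, 0 < y < 1 -> exists u : nat -> R,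
      a n (u n) @[n --> \oo] --> y /\ b n (u n) @[n --> \oo] --> y) ->
  forall e : R, 0 < e -> \forall n \near \oo, forall x, `|a n x - b n x| <= e.
Proof.
move=> b_ge0 b_le1 b_nd grid e e0.
have e30 : 0 < e / 3 by lra.
(* Levels [i / K] have mesh at most [e / 3]; adding an error [e / 3] for each of [a] and [b] gives
   [e]. *)
pose K := (Num.truncn (e / 3)^-1).+1.
have K0 : 0 < K%:R :> R by rewrite ltr0n.
have Ke : K%:R^-1 <= e / 3.
  by rewrite -[leRHS]invrK lef_pV2 ?posrE ?invr_gt0// ltW// truncnS_gt.
have [u uP] : {u : nat -> nat -> R & forall i, (0 < i < K)%N ->
    a n (u i n) @[n --> \oo] --> (i%:R / K%:R : R) /\
    b n (u i n) @[n --> \oo] --> (i%:R / K%:R : R)}.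
  apply: (@choice _ _ (fun i w => (0 < i < K)%N ->
    a n (w n) @[n --> \oo] --> (i%:R / K%:R : R) /\
    b n (w n) @[n --> \oo] --> (i%:R / K%:R : R))) => i.
  have [/andP[i0 iK]|_] := boolP (0 < i < K)%N; last by exists (fun=> 0).
  have [|w [wa wb]] := grid (i%:R / K%:R).
    by rewrite divr_gt0 ?ltr0n//= ltr_pdivrMr// mul1r ltr_nat.
  by exists w.
have close : \forall n \near \oo, forall i : 'I_K, (0 < i)%N ->
    `|i%:R / K%:R - a n (u i n)| <= e / 3 /\
    `|i%:R / K%:R - b n (u i n)| <= e / 3.
  apply: filter_forall => i; have [->|i0] := posnP i; first exact: nearW.
  have [|ua ub] := uP i; first by rewrite i0 ltn_ord.
  near=> n => _; split; near: n.
    by move/cvgrPdist_le : ua; exact.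
  by move/cvgrPdist_le : ub; exact.
near=> n => x.
have cl : forall i : 'I_K, (0 < i)%N ->
    `|i%:R / K%:R - a n (u i n)| <= e / 3 /\
    `|i%:R / K%:R - b n (u i n)| <= e / 3 by near: n.
pose pr i := (i < K)%N && ((i == 0)%N || (u i n <= x)).
have pr_ex : exists i, pr i by exists 0.
have pr_ub i : pr i -> (i <= K)%N by move=> /andP[/ltnW].
case: (ex_maxnP pr_ex pr_ub) => i /andP[iK pi] imax.
have bound (c : nat -> R -> R) : (forall u, 0 <= c n u) ->
    (forall u, c n u <= 1) -> {homo c n : u v / u <= v} ->
    (forall i : 'I_K, (0 < i)%N -> `|i%:R / K%:R - c n (u i n)| <= e / 3) ->
  i%:R / K%:R - e / 3 <= c n x <= i.+1%:R / K%:R + e / 3.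
  move=> c_ge0 c_le1 c_nd cc; apply/andP; split.
    have [i0|i0] := posnP i.
      by rewrite i0 mul0r (le_trans _ (c_ge0 _))//; lra.
    move: pi; rewrite gtn_eqF//= => /c_nd; apply: le_trans.
    have := cc (Ordinal iK) i0; rewrite /= ler_norml => /andP[]; lra.
  have [iK'|] := ltnP i.+1 K.
    have := cc (Ordinal iK') (ltn0Sn _); rewrite /= ler_norml => /andP[cli _].
    have : x <= u i.+1 n.
      rewrite leNgt; apply/negP => /ltW ux.
      have := imax i.+1; rewrite /pr iK' ux/= => /(_ isT).
      by rewrite ltnn.
    by move=> /c_nd; lra.
  move=> Ki; have -> : i.+1 = K by apply/eqP; rewrite eqn_leq iK.
  by rewrite divff ?gt_eqF// (le_trans (c_le1 _))//; lra.
have /andP[] := bound a (a_ge0 n) (a_le1 n) (@a_nd n) (fun i i0 => (cl i i0).1).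
have /andP[] := bound b (b_ge0 n) (b_le1 n) (@b_nd n) (fun i i0 => (cl i i0).2).
have -> : i.+1%:R / K%:R = i%:R / K%:R + K%:R^-1 :> R.
  by rewrite -natr1 mulrDl mul1r.
rewrite ler_norml => *; apply/andP; split; lra.
Unshelve. all: by end_near. Qed.

(** For bounded [p], both [a p (v n)] and [G (v n) ^+ p] tend to [1], so that
    [a p (v n) - G (v n) ^+ p] is small uniformly in [p]. *)
Lemma power_factor (G : R -> R) (v : nat -> R) :
    (forall x, 0 <= G x <= 1) ->
    (forall e : R, 0 < e -> \forall n \near \oo, forall x,
      `|a n x - G x ^+ n| <= e) ->
    G (v n) @[n --> \oo] --> (1 : R) ->
  forall e : R, 0 < e -> \forall n \near \oo, forall p q,
    `|a (p + q) (v n) - a p (v n) * a q (v n)| <= e.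
Proof.
move=> G01 aG Gv.
have close e : 0 < e -> \forall n \near \oo, forall p,
    `|a p (v n) - G (v n) ^+ p| <= e.
  move=> e0; have e20 : 0 < e / 2 by lra.
  have [N _ NP] := aG _ e20.
  have GN : G (v n) ^+ N @[n --> \oo] --> (1 : R).
    have := cvg_comp _ _ Gv (@exprn_continuous R N 1).
    by rewrite expr1n.
  near=> n => p; have [Np|/ltnW pN] := leqP N p.
    by rewrite (le_trans (NP _ Np _))//; lra.
  have /andP[h0 h1] := G01 (v n).
  have := NP N (leqnn N) (v n); rewrite ler_norml => /andP[k1 k2].
  have k3 : 1 - e / 2 <= G (v n) ^+ N.
    by near: n; apply: (cvgr_ge _ GN); lra.
  have k4 : G (v n) ^+ N <= G (v n) ^+ p by exact: ler_wiXn2l.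
  have k5 : G (v n) ^+ p <= 1 by exact: exprn_ile1.
  have := a_ni (v n) pN; have := a_le1 p (v n).
  by rewrite ler_norml => ? ?; apply/andP; split; lra.
move=> e e0; have e30 : 0 < e / 3 by lra.
near=> n => p q.
have cl : forall p, `|a p (v n) - G (v n) ^+ p| <= e / 3.
  by near: n; exact: close.
have /andP[h0 h1] := G01 (v n).
(* Exact splitting into three approximation errors, whose coefficients are at most 1 in absolute
   value. *)
have -> : a (p + q) (v n) - a p (v n) * a q (v n) =
    (a (p + q) (v n) - G (v n) ^+ (p + q)) +
    (- (G (v n) ^+ p * (a q (v n) - G (v n) ^+ q)) +
     - (a q (v n) * (a p (v n) - G (v n) ^+ p))) by rewrite exprD; ring.
have -> : e = e / 3 + (e / 3 + e / 3) by lra.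
apply: le_trans (ler_normD _ _) _; apply: lerD => //.
apply: le_trans (ler_normD _ _) _; rewrite !normrN !normrM.
apply: lerD; [apply: le_trans (cl q)|apply: le_trans (cl p)].
  by rewrite ger0_norm ?exprn_ge0// ler_piMl// exprn_ile1.
by rewrite (ger0_norm (a_ge0 _ _)) ler_piMl.
Unshelve. all: by end_near. Qed.

Lemma power_diag (G : R -> R) (v : nat -> R) (gamma : R) :
    (forall e : R, 0 < e -> \forall n \near \oo, forall x,
      `|a n x - G x ^+ n| <= e) ->
  G (v n) ^+ n @[n --> \oo] --> gamma -> a n (v n) @[n --> \oo] --> gamma.
Proof.
move=> aG Gv; have E : a n (v n) - G (v n) ^+ n @[n --> \oo] --> 0.
  apply/cvgr0Pnorm_le => e e0; near=> n.
  by move: (v n); near: n; exact: aG.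
rewrite -[X in _ --> X]add0r; apply: cvg_near_eq (cvgD E Gv).
by near=> n; rewrite /= subrK.
Unshelve. all: by end_near. Qed.

(** * From asymptotic factorisation to geometric limits at rational times *)

Section Multiplicative.
Context v gamma (gamma01 : 0 < gamma < 1).
Context (av : a n (v n) @[n --> \oo] --> gamma).
Context (amul : forall S e : R, 0 < S -> 0 < e -> \forall n \near \oo,
  forall p q, (1 <= p)%N -> (1 <= q)%N -> (p + q)%:R <= S * n%:R ->
    `|a (p + q) (v n) - a p (v n) * a q (v n)| <= e).

(** If an index is zero the defect vanishes because [a 0 u = 1]; hence quotients and remainders of a
    division are admissible indices. *)
Lemma cvg_factor (p q : nat -> nat) (S : R) : 0 < S ->
  (\forall n \near \oo, (p n + q n)%:R <= S * n%:R) ->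
  a (p n + q n) (v n) - a (p n) (v n) * a (q n) (v n) @[n --> \oo] --> 0.
Proof.
move=> S0 pqS; apply/cvgr0Pnorm_le => e e0; near=> n.
have [->|p0] := posnP (p n); first by rewrite a0 mul1r subrr normr0 ltW.
have [->|q0] := posnP (q n); first by rewrite addn0 a0 mulr1 subrr normr0 ltW.
have pq : (p n + q n)%:R <= S * n%:R by near: n.
by move: (p n) (q n) p0 q0 pq; near: n; exact: amul.
Unshelve. all: by end_near. Qed.

(** One factor is split off at a time; the earlier error is multiplied by a number at most 1, so the
    errors merely add up. *)
Lemma cvg_factor_pow (m : nat -> nat) (k : nat) (S : R) : 0 < S ->
  (\forall n \near \oo, (k * m n)%:R <= S * n%:R) ->
  a (k * m n) (v n) - a (m n) (v n) ^+ k @[n --> \oo] --> 0.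
Proof.
move=> S0; elim: k => [_|k IH kS].
  under eq_fun do rewrite mul0n a0 expr0 subrr; exact: cvg_cst.
have {}IH : a (k * m n) (v n) - a (m n) (v n) ^+ k @[n --> \oo] --> 0.
  apply: IH; near=> n.
  have : (k.+1 * m n)%:R <= S * n%:R by near: n.
  by apply: le_trans; rewrite ler_nat leq_mul2r leqnSn orbT.
have : a (m n + k * m n) (v n) - a (m n) (v n) * a (k * m n) (v n)
    @[n --> \oo] --> 0.
  by apply: cvg_factor S0 _; near=> n; rewrite -mulSn; near: n.
move=> /cvgr0Pnorm_le H; move/cvgr0Pnorm_le : IH => IH.
apply/cvgr0Pnorm_le => e e0.
have e20 : 0 < e / 2 by lra.
near=> n.
have H1 : `|a (m n + k * m n) (v n) - a (m n) (v n) * a (k * m n) (v n)|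
  <= e / 2 by near: n; exact: H.
have H2 : `|a (k * m n) (v n) - a (m n) (v n) ^+ k| <= e / 2.
  by near: n; exact: IH.
rewrite mulSn exprS.
rewrite -(subrKA (a (m n) (v n) * a (k * m n) (v n))) -mulrBr.
apply: (le_trans (ler_normD _ _)); rewrite [e]splitr lerD//.
rewrite normrM (ger0_norm (a_ge0 _ _)); apply: le_trans H2.
exact: ler_piMl.
Unshelve. all: by end_near. Qed.

(** For every [j], [a r (v n) ^+ j] is asymptotically [a (j * r) (v n)], which is
    at least [a n (v n) -> gamma]; now let [j] grow. *)
Lemma cvg_fixed_index (r : nat) : a r (v n) @[n --> \oo] --> (1 : R).
Proof.
case/andP: gamma01 => g0 g1.
apply/cvgrPdist_le => e e0; have [e1|e1] := leP 1 e.
  near=> n; rewrite ger0_norm ?subr_ge0//; apply: le_trans e1.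
  by rewrite gerBl.
(* If [a r (v n) < 1 - e], then [a (j * r) (v n)] is below [gamma / 2 + gamma / 4], while it is at
   least [a n (v n) >= gamma - gamma / 4]. *)
have [j jg] : exists j, (1 - e) ^+ j < gamma / 2.
  have : (1 - e) ^+ j @[j --> \oo] --> 0.
    apply: cvg_expr; rewrite ger0_norm ?subr_ge0 1?ltW//.
    by rewrite ltrBlDr ltrDl.
  move=> /cvgr_lt /(_ (gamma / 2)) /=; rewrite divr_gt0// => /(_ isT) [N _ H].
  by exists N; exact: H N (leqnn N).
have g40 : 0 < gamma / 4 by lra.
have jr : \forall n \near \oo, (j * r)%:R <= 1 * n%:R :> R.
  near=> n; rewrite mul1r ler_nat; near: n; exact: nbhs_infty_ge.
have /cvgr0Pnorm_le /(_ _ g40) H := cvg_factor_pow ltr01 jr.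
near=> n; rewrite ger0_norm ?subr_ge0// lerBlDr -lerBlDl.
have H1 : `|a (j * r) (v n) - a r (v n) ^+ j| <= gamma / 4 by near: n.
have H2 : gamma - gamma / 4 <= a n (v n).
  near: n; apply: (cvgr_ge _ av); by rewrite ltrBlDr ltrDl.
have H3 : a n (v n) <= a (j * r) (v n).
  by apply: a_ni; near: n; exact: nbhs_infty_ge.
rewrite leNgt; apply/negP => ae.
have : a r (v n) ^+ j <= (1 - e) ^+ j.
  by rewrite lerXn2r ?nnegrE ?subr_ge0// ltW.
move: H1; rewrite ler_norml => /andP[_ H1].
by lra.
Unshelve. all: by end_near. Qed.

(** Write [n] as [k * (n %/ k)] plus a remainder below [k]; by [cvg_fixed_index] the remainder
    contributes a factor tending to 1. *)
Lemma cvg_divn (k : nat) : (0 < k)%N ->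
  a (n %/ k) (v n) ^+ k @[n --> \oo] --> gamma.
Proof.
move=> k0.
have kn n : (k * (n %/ k) + n %% k)%N = n by rewrite mulnC -divn_eq.
have E1 : a n (v n) - a (k * (n %/ k)) (v n) * a (n %% k) (v n)
    @[n --> \oo] --> 0.
  have le1 : \forall n \near \oo, (k * (n %/ k) + n %% k)%:R <= 1 * n%:R :> R.
    by near=> n; rewrite kn mul1r.
  by have := cvg_factor ltr01 le1; under eq_fun do rewrite kn.
have E2 : a (k * (n %/ k)) (v n) - a (n %/ k) (v n) ^+ k @[n --> \oo] --> 0.
  apply: (cvg_factor_pow ltr01); near=> n.
  by rewrite mul1r ler_nat mulnC leq_divM.
have E3 : a (k * (n %/ k)) (v n) * (1 - a (n %% k) (v n)) @[n --> \oo] --> 0.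
  apply: (@squeeze_cvgr _ _ _ _ (fun=> 0) (fun n => 1 - a k (v n))).
  - near=> n; rewrite mulr_ge0 ?subr_ge0//=.
    apply: le_trans (ler_piMl _ (a_le1 _ _)) _; rewrite ?subr_ge0//.
    by rewrite lerD2l lerN2 a_ni// ltnW// ltn_mod.
  - exact: cvg_cst.
  - rewrite -[X in _ --> X](subrr (1 : R)); apply: cvgB; first exact: cvg_cst.
    exact: (cvg_fixed_index k).
apply: (@cvg_near_eq _ _ _ _ (fun n => a n (v n)
  - (a n (v n) - a (k * (n %/ k)) (v n) * a (n %% k) (v n))
  - (a (k * (n %/ k)) (v n) - a (n %/ k) (v n) ^+ k)
  + a (k * (n %/ k)) (v n) * (1 - a (n %% k) (v n)))).
  by near=> n; ring.
have -> : gamma = gamma - 0 - 0 + 0 by ring.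
by apply: cvgD => //; apply: cvgB => //; exact: cvgB.
Unshelve. all: by end_near. Qed.

(** The integer part of [n * l / k] lies between [l * (n %/ k)] and [l * (n %/ k) + l], and the
    extra [l] indices do not change the limit. *)
Lemma cvg_truncn_rat (k l : nat) : (0 < k)%N ->
  a (Num.truncn (n%:R * (l%:R / k%:R) : R)) (v n) @[n --> \oo]
    --> gamma `^ (l%:R / k%:R).
Proof.
case/andP: gamma01 => g0 g1 k0.
have k0R : 0 < k%:R :> R by rewrite ltr0n.
have lm n : (l * (n %/ k) <= n * l)%N.
  by rewrite mulnC leq_mul// leq_div.
have E1 : a (n %/ k) (v n) ^+ l @[n --> \oo] --> gamma `^ (l%:R / k%:R).
  apply: (cvg_near_eq _ (cvg_powR_r (l := l%:R / k%:R) g0 (cvg_divn k0))).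
  near=> n.
  rewrite -powR_mulrn// -powRrM mulrCA mulfV ?gt_eqF// mulr1.
  by rewrite powR_mulrn.
(* Using [l.+1] instead of [l] keeps the constant positive when [l = 0]. *)
have lS n : (l * (n %/ k))%:R <= l.+1%:R * n%:R :> R.
  by rewrite -natrM ler_nat leq_mul// leq_div.
have E2 : a (l * (n %/ k)) (v n) @[n --> \oo] --> gamma `^ (l%:R / k%:R).
  have F : a (l * (n %/ k)) (v n) - a (n %/ k) (v n) ^+ l @[n --> \oo] --> 0.
    by apply: (@cvg_factor_pow _ _ l.+1%:R) => //; near=> n; exact: lS.
  rewrite -[X in _ --> X](add0r (gamma `^ (l%:R / k%:R))).
  by apply: cvg_near_eq (cvgD F E1); near=> n; rewrite /= subrK.
have E3 : a (l * (n %/ k) + l) (v n) @[n --> \oo] --> gamma `^ (l%:R / k%:R).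
  have F : a (l * (n %/ k) + l) (v n) - a (l * (n %/ k)) (v n) * a l (v n)
      @[n --> \oo] --> 0.
    apply: (@cvg_factor _ _ (l.+1%:R + l.+1%:R)); first by rewrite addr_gt0.
    near=> n; rewrite natrD mulrDl lerD//.
    rewrite -natrM ler_nat (leq_trans (leqnSn l))// leq_pmulr//.
    by near: n; exact: nbhs_infty_gt.
  rewrite -[X in _ --> X](mulr1 (gamma `^ (l%:R / k%:R))).
  rewrite -[X in _ --> X](add0r (gamma `^ (l%:R / k%:R) * 1)).
  apply: cvg_near_eq (cvgD F (cvgM E2 (cvg_fixed_index l))).
  by near=> n; rewrite /= subrK.
apply: squeeze_cvgr E3 E2; near=> n; apply/andP; split; apply: a_ni.
  rewrite truncn_le_nat (@le_lt_trans _ _ (l * (n %/ k) + l)%:R)//.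
    rewrite mulrA ler_pdivrMr// -!natrM ler_nat -mulnSr -mulnA [(n * l)%N]mulnC.
    by rewrite leq_mul2l ltnW ?orbT// ltn_ceil.
  by rewrite ltr_nat.
rewrite truncn_ge_nat ?mulr_ge0// ?invr_ge0//.
rewrite mulrA ler_pdivlMr// -!natrM ler_nat -mulnA [(n * l)%N]mulnC.
by rewrite leq_mul2l leq_divM orbT.
Unshelve. all: by end_near. Qed.

End Multiplicative.

(** * Consequences of geometric limits on a dense set of times *)

Section Geometric.
Context v gamma (gamma01 : 0 < gamma < 1) (Q : set R).
Context (Q_dense : [set t | 0 < t] `<=` closure Q).
Context (aQ : forall t, Q t ->
  a (Num.truncn (n%:R * t : R)) (v n) @[n --> \oo] --> gamma `^ t).

Lemma dense_itv (x y : R) : 0 <= x -> x < y -> exists2 t, Q t & x < t < y.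
Proof.
move=> x0 xy; have /Q_dense : 0 < (x + y) / 2 by lra.
move=> /(_ `]x, y[%classic) [|t [Qt]].
  by apply: near_in_itvoo; rewrite in_itv/=; apply/andP; split; lra.
by rewrite /= in_itv/=; exists t.
Qed.

(** Pick [s1 < t < s2] in [Q] with powers of [gamma] close to [gamma] to the [t]. Eventually
    [n k / m k] lies between them, and monotonicity in the index traps [a (n k) (v (m k))]. *)
Lemma cvg_ratio (m n : nat -> nat) (t : R) : 0 < t ->
  m k @[k --> \oo] --> \oo -> (n k)%:R / (m k)%:R @[k --> \oo] --> t ->
  a (n k) (v (m k)) @[k --> \oo] --> gamma `^ t.
Proof.
case/andP: gamma01 => g0 g1 t0 moo nmt.
have aQm s : Q s ->
    a (Num.truncn ((m k)%:R * s)) (v (m k)) @[k --> \oo] --> gamma `^ s.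
  by move=> /aQ As; exact: (cvg_comp _ _ moo As).
have m_gt0 : \forall k \near \oo, (0 < m k)%N by move/cvgnyPgt : moo; exact.
have : gamma `^ s @[s --> t] --> gamma `^ t by exact: cvg_powR_l.
move=> /cvgrPdist_le cont.
apply/cvgrPdist_le => e e0.
have e20 : 0 < e / 2 by lra.
have [r /= r0 rP] := cont _ e20.
have [s1 Qs1 /andP[]] : exists2 s, Q s & Num.max 0 (t - r) < s < t.
  by apply: dense_itv; rewrite ?le_max ?lexx// gt_max t0 ltrBlDr ltrDl.
rewrite gt_max => /andP[s10 rs1] s1t.
have [s2 Qs2 /andP[ts2 s2r]] : exists2 s, Q s & t < s < t + r.
  by apply: dense_itv; rewrite ?ltW// ltrDl.
have P1 : `|gamma `^ t - gamma `^ s1| <= e / 2.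
  by apply: rP; rewrite /= ltr_distl; apply/andP; split; lra.
have P2 : `|gamma `^ t - gamma `^ s2| <= e / 2.
  by apply: rP; rewrite /= ltr_distl; apply/andP; split; lra.
near=> k.
have mk0 : 0 < (m k)%:R :> R by rewrite ltr0n; near: k.
have H1 : `|gamma `^ s1 - a (Num.truncn ((m k)%:R * s1)) (v (m k))| <= e / 2.
  by near: k; move: (aQm _ Qs1) => /cvgrPdist_le; exact.
have H2 : `|gamma `^ s2 - a (Num.truncn ((m k)%:R * s2)) (v (m k))| <= e / 2.
  by near: k; move: (aQm _ Qs2) => /cvgrPdist_le; exact.
have K1 : a (n k) (v (m k)) <= a (Num.truncn ((m k)%:R * s1)) (v (m k)).
  apply: a_ni; rewrite truncn_le_nat.
  have : s1 < (n k)%:R / (m k)%:R by near: k; exact: (cvgr_gt _ nmt).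
  rewrite ltr_pdivlMr// mulrC => /lt_trans; apply.
  by rewrite ltr_nat.
have s20 : 0 <= s2 by lra.
have K2 : a (Num.truncn ((m k)%:R * s2)) (v (m k)) <= a (n k) (v (m k)).
  apply: a_ni; rewrite truncn_ge_nat ?mulr_ge0//.
  have : (n k)%:R / (m k)%:R < s2 by near: k; exact: (cvgr_lt _ nmt).
  by rewrite ltr_pdivrMr// mulrC => /ltW.
move: P1 P2 H1 H2; rewrite !ler_norml.
move=> /andP[? ?] /andP[? ?] /andP[? ?] /andP[? ?].
by apply/andP; split; lra.
Unshelve. all: by end_near. Qed.

Lemma cvg_diag : a n (v n) @[n --> \oo] --> gamma.
Proof.
case/andP: gamma01 => g0 g1.
rewrite -[X in _ --> X](powRr1 (ltW g0)); apply: (@cvg_ratio id id) => //.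
apply: (@cvg_near_eq _ _ _ _ (fun=> 1)); last exact: cvg_cst.
near=> n; rewrite divff// pnatr_eq0 -lt0n.
by near: n; exact: nbhs_infty_gt.
Unshelve. all: by end_near. Qed.

Lemma cvg_grid (t : R) : 0 < t ->
  a n (v (Num.truncn (n%:R * t))) @[n --> \oo] --> gamma `^ t^-1.
Proof.
move=> t0; apply: (@cvg_ratio _ id); rewrite ?invr_gt0//.
  exact: truncn_infty.
apply: cvg_near_eq (cvgV (lt0r_neq0 t0) (truncn_ratio t0)).
by near=> n; rewrite /= invf_div.
Unshelve. all: by end_near.
Qed.

(** If [v] were eventually constant, [a (2 * k) (v k)] and [a (2 * k) (v (2 * k))] would eventually
    agree, yet their limits are [gamma ^ 2] and [gamma]. *)
Lemma ex_jump : (forall m n, (1 <= m)%N -> (m <= n)%N -> v m <= v n) ->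
  forall n, exists m, (n <= m)%N && (v m < v m.+1).
Proof.
case/andP: gamma01 => g0 g1 v_nd n; apply: contrapT => nojump.
have vconst m : (n.+1 <= m)%N -> v m = v n.+1.
  elim: m => // m IH; rewrite ltnS leq_eqVlt => /predU1P[->//|nm].
  rewrite -(IH nm); apply: le_anti; apply/andP; split; last first.
    by apply: v_nd => //; exact: leq_trans nm.
  rewrite leNgt; apply/negP => vm; apply: nojump; exists m.
  by rewrite vm andbT ltnW.
have C1 : a (k.+1.*2) (v k.+1) @[k --> \oo] --> gamma `^ 2.
  apply: (@cvg_ratio S (fun k => k.+1.*2)) => //.
    apply/cvgnyPge => A; near=> k; rewrite ltnW//.
    by near: k; exact: nbhs_infty_ge.
  apply: (@cvg_near_eq _ _ _ _ (fun=> 2)); last exact: cvg_cst.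
  by near=> k; rewrite -muln2 natrM mulrAC divff ?mul1r.
have C2 : a (k.+1.*2) (v k.+1.*2) @[k --> \oo] --> gamma.
  apply: (@cvg_comp _ _ _ (fun k => k.+1.*2) (fun n => a n (v n)) _ \oo).
    apply/cvgnyPge => A; near=> k; rewrite -addnn (leq_trans _ (leq_addr _ _))//.
    by rewrite ltnW//; near: k; exact: nbhs_infty_ge.
  exact: cvg_diag.
have C3 : a (k.+1.*2) (v k.+1) @[k --> \oo] --> gamma.
  apply: cvg_near_eq C2; near=> k.
  have nk : (n.+1 <= k.+1)%N by rewrite ltnS; near: k; exact: nbhs_infty_ge.
  rewrite (vconst k.+1)// (vconst k.+1.*2)//.
  by rewrite (leq_trans nk)// -addnn leq_addr.
have /eqP : gamma `^ 2 = gamma by exact: (cvg_unique _ C1 C3).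
rewrite powR_mulrn ?(ltW g0)// expr2 -subr_eq0 -{3}(mulr1 gamma) -mulrBr.
rewrite mulf_eq0 gt_eqF//= subr_eq0.
by rewrite lt_eqF.
Unshelve. all: by end_near. Qed.

(** If [N n >= (1 + e) * n] for infinitely many [n], then along them
    [a (N n) (v (N n)) <= a (truncn (n * (1 + e))) (v n)], but the two sides tend
    to [gamma] and to [gamma `^ (1 + e)]. *)
Lemma block_ratio (N : nat -> nat) :
    (forall n, (1 <= n)%N -> (n <= N n)%N /\ v (N n) = v n) ->
  (N n)%:R / n%:R @[n --> \oo] --> (1 : R).
Proof.
case/andP: gamma01 => g0 g1 NP; apply/cvgrPdist_le => e e0.
have ge : gamma `^ (1 + e) < gamma.
  rewrite powRD; last by rewrite (gt_eqF g0) implybT.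
  rewrite powRr1 ?(ltW g0)// -[ltRHS]mulr1 ltr_pM2l//.
  by rewrite /powR gt_eqF// -expR0 ltr_expR pmulr_rlt0// ln_lt0// g0.
pose c := (gamma `^ (1 + e) + gamma) / 2.
have gc : c < gamma by rewrite /c; lra.
have cg : gamma `^ (1 + e) < c by rewrite /c; lra.
have : a (Num.truncn (n%:R * (1 + e))) (v n) @[n --> \oo] --> gamma `^ (1 + e).
  by apply: (@cvg_ratio id) => //; [lra|apply: truncn_ratio; lra].
move=> /cvgr_lt /(_ _ cg) lt_c.
have [M _ MP] := cvgr_gt _ cvg_diag _ gc.
near=> n.
have n0 : (0 < n)%N by near: n; exact: nbhs_infty_gt.
have n0R : 0 < n%:R :> R by rewrite ltr0n.
have [nN vN] := NP n n0.
have nN1 : 1 <= (N n)%:R / n%:R :> R by rewrite ler_pdivlMr// mul1r ler_nat.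
rewrite ler0_norm ?subr_le0// opprB lerBlDl.
rewrite leNgt; apply/negP; rewrite ltr_pdivlMr// mulrC => eN.
have : c < a (N n) (v (N n)).
  by apply: MP; rewrite /= (leq_trans _ nN)//; near: n; exact: nbhs_infty_ge.
have tN : (Num.truncn (n%:R * (1 + e)) <= N n)%N.
  by rewrite truncn_le_nat (lt_trans eN)// ltr_nat.
rewrite vN => /lt_le_trans /(_ (a_ni _ tN)).
by apply/negP; rewrite -leNgt ltW//; near: n.
Unshelve. all: by end_near. Qed.

(** Since [a (2 * m) (v m)] tends to [gamma ^ 2 < gamma], one has [v m < v n] for
    large [m] and [n >= 2 * m]; hence the running maximum at [n] is [v k] for some
    [k] with [n / 2 < k <= n]. *)
Lemma running_max : exists2 w : nat -> R,
    forall m n, (m <= n)%N -> w m <= w n &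
  forall t : R, 0 < t ->
    a (Num.truncn (n%:R * t : R)) (w n) @[n --> \oo] --> gamma `^ t.
Proof.
case/andP: gamma01 => g0 g1.
have g2 : gamma `^ 2 < gamma.
  by rewrite powR_mulrn ?ltW// expr2 -[ltRHS]mulr1 ltr_pM2l.
pose c := (gamma `^ 2 + gamma) / 2.
have gc : c < gamma by rewrite /c; lra.
have cg : gamma `^ 2 < c by rewrite /c; lra.
have cvt (t : R) : 0 < t ->
    a (Num.truncn (n%:R * t)) (v n) @[n --> \oo] --> gamma `^ t.
  by move=> t0; apply: (@cvg_ratio id) => //; exact: truncn_ratio.
have [N1 _ N1P] := cvgr_lt _ (cvt 2 (ltr0Sn _ 1)) _ cg.
have [N2 _ N2P] := cvgr_gt _ cvg_diag _ gc.
pose N := (maxn N1 N2).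
have v_lt m n : (N <= m)%N -> (m.*2 <= n)%N -> v m < v n.
  rewrite geq_max => /andP[N1m N2m] mn; rewrite ltNge; apply/negP => vnm.
  have := N1P m N1m; rewrite /= -natrM natrK muln2.
  apply/negP; rewrite -leNgt; apply: le_trans (a_ni _ mn).
  apply: le_trans (a_nd n vnm); apply: ltW; apply: N2P.
  by rewrite /= (leq_trans N2m)// (leq_trans _ mn)// -addnn leq_addr.
(* [kap n] is an index where the running maximum of [v] from [N] to [n] is attained; it stays at [N]
   until [n] exceeds [N]. *)
pose fix kap n := if n is n'.+1 then
  if ((N <= n'.+1)%N && (v (kap n') < v n'.+1)) then n'.+1 else kap n' else N.
have kap_ge n : (N <= kap n)%N.
  by elim: n => //= n IH; case: ifPn => // /andP[].
have kap_le n : (N <= n)%N -> (kap n <= n)%N.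
  elim: n => [|n IH]/=; first by rewrite leqn0 => /eqP ->.
  case: ifPn => // _; rewrite leq_eqVlt => /predU1P[Nn|/IH /leq_trans]; last exact.
  suff -> : kap n = N by rewrite Nn.
  have : (n < N)%N by rewrite Nn.
  elim: n {IH Nn} => //= n IH nN; rewrite leqNgt nN/=; exact/IH/ltnW.
have v_kap n : v (kap n) <= v (kap n.+1).
  by rewrite /=; case: ifPn => // /andP[_ /ltW].
have kap_nd : forall m n, (m <= n)%N -> v (kap m) <= v (kap n).
  exact: ((nondecreasing_seqP (fun n => v (kap n))).1 v_kap).
have v_le n : (N <= n)%N -> v n <= v (kap n).
  case: n => [|n] /=; first by rewrite leqn0 => /eqP ->.
  by move=> ->/=; case: ifPn => // ; rewrite -leNgt.
have kap_half n : (N <= n)%N -> (n < (kap n).*2)%N.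
  move=> Nn; rewrite ltnNge; apply/negP => /(v_lt _ _ (kap_ge n)).
  by apply/negP; rewrite -leNgt v_le.
have kap_oo : kap n @[n --> \oo] --> \oo.
  apply/cvgnyPge => A; near=> n.
  have : (A.*2 <= n)%N by near: n; exact: nbhs_infty_ge.
  move=> An; rewrite -leq_double (leq_trans An)// ltnW// kap_half//.
  by near: n; exact: nbhs_infty_ge.
exists (fun n => v (kap n)) => // t t0.
have := cvg_comp _ _ kap_oo (cvt t t0) => /= ck.
(* The lower bound uses [v n <= v (kap n)]; the upper bound uses [kap n <= n], which shortens the
   index at the same level. *)
apply: (squeeze_cvgr _ (cvt t t0) ck); near=> n.
have Nn : (N <= n)%N by near: n; exact: nbhs_infty_ge.
rewrite a_nd ?v_le//= a_ni// le_truncn// ler_wpM2r ?(ltW t0)//.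
by rewrite ler_nat kap_le.
Unshelve. all: by end_near. Qed.

Lemma exponent_uniform (p : nat -> nat) (g : R -> R) :
    jump_indices v p -> exponent_jump v p g ->
  forall e : R, 0 < e ->
    \forall n \near \oo, forall x, `|a n x - (gamma `^ g x) ^+ n| <= e.
Proof.
have /andP[g0 g1] := gamma01; move=> jp gp.
(* [N n] is the last index of the block containing [n], where [g] takes an interpolation value. *)
have [N NP] : {N : nat -> nat & forall n, (1 <= n)%N ->
    [/\ (n <= N n)%N, v (N n) = v n & g (v n) = (N n)%:R^-1]}.
  apply: (@choice _ _ (fun n Nn => (1 <= n)%N ->
    [/\ (n <= Nn)%N, v Nn = v n & g (v n) = Nn%:R^-1])) => n.
  have [->|n0] := posnP n; first by exists 0%N.
  have [k [k1 nk vk]] := jump_block jp n0; exists (p k) => _; split => //.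
  by rewrite -vk; case: gp => _ ->.
have N1 : (N n)%:R / n%:R @[n --> \oo] --> (1 : R).
  by apply: block_ratio => n /NP[].
have gg0 x : 0 < gamma `^ g x by exact: powR_gt0.
have gg1 x : gamma `^ g x <= 1.
  rewrite -(powRr0 gamma); apply: ger_powR; first by rewrite g0 (ltW g1).
  (* [g] is nonincreasing, so [0 <= g x] follows from a point [y >= x] past [v (p 1)], where
     [exponent_bounds] applies. *)
  have [y [xy /andP[gy _]]] : exists y, x <= y /\ 0 <= g y <= (p 1%N)%:R^-1.
    exists (Num.max x (v (p 1%N))); split; first by rewrite le_max lexx.
    by apply: (exponent_bounds jp gp) => //; rewrite le_max lexx orbT.
  exact: le_trans (exponent_ni jp gp xy).
apply: polya_uniform => //.
- by move=> n u; rewrite exprn_ge0// (ltW (gg0 u)).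
- by move=> n u; rewrite exprn_ile1// (ltW (gg0 u)).
- move=> n x y xy; rewrite lerXn2r ?nnegrE ?(ltW (gg0 _))//.
  by apply: ger_powR; [rewrite g0 (ltW g1)|exact: (exponent_ni jp gp)].
move=> y /andP[y0 y1].
have lg : ln gamma < 0 by rewrite ln_lt0// g0.
have ly : ln y < 0 by rewrite ln_lt0// y0.
pose t := ln gamma / ln y.
have t0 : 0 < t by rewrite /t -mulrNN -invrN divr_gt0 ?oppr_gt0.
have gt : gamma `^ t^-1 = y.
  by rewrite /powR gt_eqF// invf_div divfK ?lt_eqF// lnK// posrE.
pose m n := Num.truncn (n%:R * t : R).
exists (fun n => v (m n)); rewrite -gt; split; first exact: cvg_grid.
have moo : m n @[n --> \oo] --> \oo := truncn_infty t0.
(* The exponent of [gamma] at [v (m n)] is [n / N (m n)], so this ratio decides the limit; it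
   factors through [N (m n) / m n -> 1] and [m n / n -> t]. *)
have C : (N (m n))%:R / n%:R @[n --> \oo] --> t.
  have N2 : (N (m n))%:R / (m n)%:R @[n --> \oo] --> (1 : R).
    exact: (cvg_comp _ _ moo N1).
  rewrite -[X in _ --> X]mul1r.
  apply: cvg_near_eq (cvgM N2 (truncn_ratio t0)); near=> n.
  rewrite /= mulrA divfK// pnatr_eq0 -lt0n.
  by near: n; move/cvgnyPgt : moo; exact.
apply: cvg_near_eq (cvg_powR_l g0 (cvgV (lt0r_neq0 t0) C)); near=> n.
have m0 : (1 <= m n)%N by near: n; move/cvgnyPgt : moo; exact.
have [_ _ ->] := NP _ m0.
by rewrite -powR_mulrn ?powR_ge0// -powRrM /= invf_div mulrC.
Unshelve. all: by end_near. Qed.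

End Geometric.
End Asymptotics.

(** * The conditions for partial maxima and the implications between them *)

Section Equivalence.
Context (d : measure_display) (T : measurableType d) (R : realType).
Context (P : probability T R) (X : nat -> {RV P >-> R}).
Implicit Types (v : nat -> R) (gamma : R).

Lemma phantom_dfP (G : R -> R) : distribution_function G ->
  phantom_df X G <-> (forall e : R, 0 < e -> \forall n \near \oo,
    forall u, `|prob_max_le X n u - G u ^+ n| <= e).
Proof.
move=> dG.
have E : ereal_sup [set (`|prob_max_le X n u - G u ^+ n|)%:E | u in [set: R]]
    @[n --> \oo] --> 0%E <-> (forall e : R, 0 < e -> \forall n \near \oo,
    forall u, setT u -> `|prob_max_le X n u - G u ^+ n| <= e).
  apply: (@ereal_sup_cvg0P R R (fun=> setT)
    (fun n u => `|prob_max_le X n u - G u ^+ n|)) => //.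
  by near=> n; exists 0.
split=> [[_ /E H] e e0|H]; first by apply: filterS (H e e0) => n + u; exact.
by split => //; apply/E => e e0; apply: filterS (H e e0).
Unshelve. all: by end_near. Qed.

Lemma factor_error_ge0 v (n p q : nat) : 0 <= factor_error X v n p q.
Proof. exact: normr_ge0. Qed.

Lemma cond_iiiP v gamma : cond_iii X v gamma <->
  prob_max_le X n (v n) @[n --> \oo] --> gamma /\
  (forall e : R, 0 < e -> \forall n \near \oo, forall pq : nat * nat,
    (1 <= pq.1)%N /\ (1 <= pq.2)%N -> factor_error X v n pq.1 pq.2 <= e).
Proof.
have E := @ereal_sup_cvg0P R (nat * nat)%type
  (fun=> [set pq : nat * nat | (1 <= pq.1)%N /\ (1 <= pq.2)%N])
  (fun n pq => factor_error X v n pq.1 pq.2).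
have {}E := E (fun n pq => factor_error_ge0 v n pq.1 pq.2)
  (nearW _ (fun=> ex_intro _ (1, 1)%N (conj (leqnn 1) (leqnn 1)))).
by split=> -[av /E H]; split.
Qed.

Lemma cond_ivP v gamma : cond_iv X v gamma <->
  prob_max_le X n (v n) @[n --> \oo] --> gamma /\
  (forall S e : R, 0 < S -> 0 < e -> \forall n \near \oo, forall pq : nat * nat,
    [/\ (1 <= pq.1)%N, (1 <= pq.2)%N & (pq.1 + pq.2)%:R <= S * n%:R] ->
    factor_error X v n pq.1 pq.2 <= e).
Proof.
have E (S : R) := @ereal_sup_cvg0P R (nat * nat)%type
  (fun n => [set pq : nat * nat | [/\ (1 <= pq.1)%N, (1 <= pq.2)%N
    & (pq.1 + pq.2)%:R <= S * n%:R]])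
  (fun n pq => factor_error X v n pq.1 pq.2)
  (fun n pq => factor_error_ge0 v n pq.1 pq.2).
have D0 (S : R) : 0 < S -> \forall n \near \oo,
    [set pq : nat * nat | [/\ (1 <= pq.1)%N, (1 <= pq.2)%N
      & (pq.1 + pq.2)%:R <= S * n%:R]] !=set0.
  (* The pair [(1, 1)] is admissible as soon as [n >= 2 / S]. *)
  move=> S0; near=> n; exists (1, 1)%N; split => //=.
  by rewrite mulrC -ler_pdivrMr//; near: n; exact: nbhs_infty_ger.
split=> -[av H]; split => // S.
  by move=> e S0 e0; have /(E _ (D0 _ S0)) := H S S0; exact.
by move=> S0; apply/(E _ (D0 _ S0)) => e e0; exact: H.
Unshelve. all: by end_near. Qed.

Lemma cond_iii_iv v gamma : cond_iii X v gamma -> cond_iv X v gamma.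
Proof.
move=> /cond_iiiP[av H]; apply/cond_ivP; split => // S e _ e0.
by apply: filterS (H e e0) => n Hn pq [p1 q1 _]; exact: Hn.
Qed.

Lemma cond_iv_v v gamma : 0 < gamma < 1 ->
  cond_iv X v gamma -> cond_v X v gamma.
Proof.
move=> gamma01 /cond_ivP[av H].
(* The dense set is that of the positive rationals. *)
exists [set t | exists k l, [/\ (0 < k)%N, (0 < l)%N & t = l%:R / k%:R]].
split.
- by move=> _ [k [l [k0 l0 ->]]] /=; rewrite divr_gt0 ?ltr0n.
- move=> t /= t0 B /nbhs_ballP[r /= r0 rB].
  (* Here [1 / k < r], and [l / k] is the first multiple of [1 / k] beyond [t], so
     [t < l / k < t + r]. *)
  pose k := (Num.truncn r^-1).+1; pose l := (Num.truncn (t * k%:R)).+1.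
  have k0 : 0 < k%:R :> R by rewrite ltr0n.
  have rk : 1 < r * k%:R by rewrite -ltr_pdivrMl// mulr1 truncnS_gt.
  exists (l%:R / k%:R); split; first by exists k, l.
  have /andP[h1 h2] := truncn_itv (mulr_ge0 (ltW t0) (ltW k0)).
  apply: rB; rewrite /ball/= ltr_distlC; apply/andP; split.
    by rewrite ltr_pdivlMr//; apply: lt_trans h2; rewrite ltr_pM2r//; lra.
  by rewrite ltr_pdivrMr// mulrDl /l -natr1; lra.
- move=> _ [k [l [k0 l0 ->]]].
  apply: (cvg_truncn_rat (a := prob_max_le X)) => //.
  + exact: prob_max_le0.
  + exact: prob_max_le_ge0.
  + exact: prob_max_le_le1.
  + by move=> m n u; exact: prob_max_le_ni.
  + move=> S e S0 e0; apply: filterS (H S e S0 e0) => n Hn p q p1 q1 pq.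
    exact: Hn (p, q) (And3 p1 q1 pq).
Qed.

Lemma cond_v_phantom v gamma (p : nat -> nat) (g : R -> R) :
  0 < gamma < 1 -> cond_v X v gamma ->
  jump_indices v p -> exponent_jump v p g ->
  continuous_phantom_df X (fun x => gamma `^ g x).
Proof.
move=> gamma01 [Q [_ Qd Qa]] jp gp; split.
  move=> x; apply: cvg_powR_l; first by case/andP: gamma01.
  exact: (exponent_continuous jp gp).
apply/phantom_dfP; first exact: (exponent_df jp gp).
apply: (exponent_uniform (a := prob_max_le X) _ _ _ _ gamma01 Qd Qa jp gp).
- exact: prob_max_le_ge0.
- exact: prob_max_le_le1.
- exact: prob_max_le_nd.
- by move=> m n u; exact: prob_max_le_ni.
Qed.

Lemma cond_v_jump_indices v gamma : 0 < gamma < 1 -> cond_v X v gamma ->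
  non_decreasing v -> exists p, jump_indices v p.
Proof.
move=> gamma01 [Q [_ Qd Qa]] v_nd; apply: jump_indices_ex => //.
apply: (ex_jump (a := prob_max_le X) _ gamma01 Qd Qa) => //.
by move=> m n u; exact: prob_max_le_ni.
Qed.

Lemma cond_v_nondecreasing v gamma : 0 < gamma < 1 -> cond_v X v gamma ->
  exists2 w, non_decreasing w & cond_v X w gamma.
Proof.
move=> gamma01 [Q [_ Qd Qa]].
have [||w w_nd aw] := running_max (a := prob_max_le X) _ _ gamma01 Qd Qa.
- exact: prob_max_le_nd.
- by move=> m n u; exact: prob_max_le_ni.
exists w; first by move=> m n _; exact: w_nd.
exists [set t | 0 < t]; split => //; exact: subset_closure.
Qed.

Lemma regular_cond_iii (G : R -> R) gamma : 0 < gamma < 1 ->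
  regular_df G -> phantom_df X G -> exists v, cond_iii X v gamma.
Proof.
move=> gamma01 rG pG; have dG := pG.1.
have [v v1 vg] := regular_sequence dG gamma01 rG.
have /phantom_dfP aG := pG; exists v; apply/cond_iiiP; split.
  exact: (power_diag (aG dG)).
move=> e e0.
have := power_factor (a := prob_max_le X) _ _ _ (df_bounds dG) (aG dG) v1 e0.
move=> /(_ (prob_max_le_ge0 X) (prob_max_le_le1 X)
  (fun m n u => @prob_max_le_ni _ _ _ _ X m n u)).
by apply: filterS => n Hn pq _; exact: Hn.
Qed.

End Equivalence.

(** * Cycle of implications and explicit phantom distribution functions *)

Theorem theorem2p3 (d : measure_display) (T : measurableType d) (R : realType)
    (P : probability T R) (X : nat -> {RV P >-> R}) (hX : stationary X) :
  [<-> exists G : R -> R, continuous_phantom_df X G;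
       exists G : R -> R, regular_df G /\ phantom_df X G;
       exists (v : nat -> R) (gamma : R), 0 < gamma < 1 /\ cond_iii X v gamma;
       exists (v : nat -> R) (gamma : R), 0 < gamma < 1 /\ cond_iv X v gamma;
       exists (v : nat -> R) (gamma : R), 0 < gamma < 1 /\ cond_v X v gamma]
  /\
  (forall (v : nat -> R) (gamma : R), 0 < gamma < 1 ->
     cond_iii X v gamma \/ cond_iv X v gamma \/ cond_v X v gamma ->
     (strictly_increasing v ->
        (exists g : R -> R, exponent_strict v g) /\
        (forall g : R -> R, exponent_strict v g ->
           continuous_phantom_df X (fun x => gamma `^ g x)))
     /\
     (non_decreasing v ->
        (exists p : nat -> nat, jump_indices v p) /\
        (forall p : nat -> nat, jump_indices v p ->
           (exists g : R -> R, exponent_jump v p g) /\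
           (forall g : R -> R, exponent_jump v p g ->
              continuous_phantom_df X (fun x => gamma `^ g x))))).
Proof.
split.
  tfae.
  - move=> [G [cG pG]]; exists G; split => //.
    exact: continuous_regular pG.1 cG.
  - move=> [G [rG pG]].
    (* The quantile construction works at every level in [(0, 1)]; one half is a choice. *)
    have half01 : 0 < (2^-1 : R) < 1 by apply/andP; split; lra.
    by have [v vP] := regular_cond_iii half01 rG pG; exists v, 2^-1.
  - move=> [v [gamma [g01 H]]]; exists v, gamma; split => //.
    exact: cond_iii_iv.
  - move=> [v [gamma [g01 H]]]; exists v, gamma; split => //.
    exact: cond_iv_v.
  - move=> [v [gamma [g01 H]]].
    have [w w_nd wP] := cond_v_nondecreasing g01 H.
    have [p jp] := cond_v_jump_indices g01 wP w_nd.
    have [g gp] := exponent_jump_ex jp.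
    by exists (fun x => gamma `^ g x); exact: (cond_v_phantom g01 wP jp gp).
move=> v gamma g01 H.
(* Conditions (iii) and (iv) imply (v) with the same [v] and [gamma], so the explicit formulas are
   derived from (v) alone. *)
have {}H : cond_v X v gamma.
  by case: H => [/cond_iii_iv|[]]//; exact: cond_iv_v.
split=> [v_lt|v_nd].
  (* The strict case is the jump case in which every index is a jump. *)
  have jp := jump_indices_id v_lt; split.
    by have [g gp] := exponent_jump_ex jp; exists g; exact/exponent_strictP.
  by move=> g /(exponent_strictP _ v_lt) gp; exact: (cond_v_phantom g01 H jp gp).
split; first exact: cond_v_jump_indices H v_nd.
move=> p jp; split; first exact: exponent_jump_ex.
by move=> g; exact: cond_v_phantom.
Qed.
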